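(* Assume that there is $\varepsilon>0$ with $\sum_{p\ge1}\beta_p^2(1+\varepsilon)^p\sum_{\mathsf s\in\mathscr S^p}\Delta^2_{\mathsf s}\lambda^{\mathsf s}<\infty$. Then there exists a $\boldsymbol\lambda$-admissible pair $(\widetilde\zeta,\widetilde\Phi)$ such that $$\mathscr P(\widetilde\zeta,\widetilde\Phi)=\inf_{\zeta,\Phi}\mathscr P(\zeta,\Phi),$$ where the infimum is over all $\boldsymbol\lambda$-admissible pairs.
   Context: Let $\mathscr S$ be a finite set and $\boldsymbol\lambda=(\lambda^s)_{s\in\mathscr S}$ with $\lambda^s\in(0,1]$, $\sum_s\lambda^s=1$. For each $p\ge1$ let $(\Delta^2_{s_1,\dots,s_p})_{s_1,\dots,s_p\in\mathscr S}$ be a symmetric array of nonnegative reals, and $\beta_p\in\mathbb R$. For $\mathsf s=(s_1,\dots,s_p)$ and $\boldsymbol q=(q^s)_{s\in\mathscr S}$ write $q^{\mathsf s}=q^{s_1}\cdots q^{s_p}$, similarly $\lambda^{\mathsf s}$. For $\boldsymbol q\in[-1,1]^{\mathscr S}$ set $$\xi(\boldsymbol q)=\sum_{p\ge1}\beta_p^2\sum_{\mathsf s\in\mathscr S^p}\Delta^2_{\mathsf s}\lambda^{\mathsf s}q^{\mathsf s},\qquad \xi^s(\boldsymbol q)=\frac1{\lambda^s}\frac{\partial\xi}{\partial q^s}(\boldsymbol q),\qquad\theta(\boldsymbol q)=\boldsymbol q\cdot\nabla\xi(\boldsymbol q)-\xi(\boldsymbol q).$$ A map $\Phi=(\Phi^s)_{s\in\mathscr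 S}:[0,1]\to[0,1]^{\mathscr S}$ is $\boldsymbol\lambda$-admissible if every $\Phi^s$ is continuous and non-decreasing and $\sum_s\lambda^s\Phi^s(q)=q$ for all $q\in[0,1]$. A $\boldsymbol\lambda$-admissible pair $(\zeta,\Phi)$ consists of a Borel probability measure $\zeta$ on $[0,1]$ and a $\boldsymbol\lambda$-admissible map $\Phi$ (which is automatically Lipschitz, so the derivatives below exist a.e.). Parisi functional: let $d^s(q)=\int_q^1\zeta([0,u])(\xi^s\circ\Phi)'(u)\,du$; for $\boldsymbol b\in(0,\infty)^{\mathscr S}$ with $b^s>d^s(0)$ for each $s$, let $$A(\zeta,\Phi,\boldsymbol b)=\sum_{s\in\mathscr S}\frac{\lambda^s}2\Big[b^s-1-\log b^s+\frac{\xi^s(\boldsymbol 0)}{b^s-d^s(0)}+\int_0^1\frac{(\xi^s\circ\Phi)'(q)}{b^s-d^s(q)}\,dq\Big]-\frac12\int_0^1\zeta([0,q])(\theta\circ\Phi)'(q)\,dq,$$ and $\mathscr P(\zeta,\Phi)=\inf_{\boldsymbol b}A(\zeta,\Phi,\boldsymbol b)$ over all such $\boldsymbol b$. *)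

(* Defs.v *)
From HB Require Import structures.
From mathcomp Require Import all_boot all_order all_algebra.
From mathcomp Require Import all_classical all_reals all_analysis.

Set Implicit Arguments.
Unset Strict Implicit.
Unset Printing Implicit Defensive.

Import Order.TTheory GRing.Theory Num.Theory.
Import numFieldNormedType.Exports.

Local Open Scope classical_set_scope.
Local Open Scope ring_scope.

(* A point of R^S is a function S -> R. The variance array is a family
   Delta2 p : p.-tuple S -> R; its value stands for the square of the array
   entry, and only the arities p >= 1 are ever used. *)

Definition mon (R : realType) (S : finType) (q : S -> R) (p : nat)
  (t : p.-tuple S) : R := \prod_(i < p) q (tnth t i).

(* The partial sums are over 1 <= p < N. *)
Definition xi (R : realType) (S : finType) (lam : S -> R) (beta : nat -> R)
    (Delta2 : forall p : nat, p.-tuple S -> R) (q : S -> R) : R :=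
  limn (fun N : nat => \sum_(1 <= p < N) beta p ^+ 2 *
          \sum_(t : p.-tuple S) Delta2 p t * mon lam t * mon q t).

(* This is the two-sided partial derivative, also at the faces q s = 1 or
   q s = -1 of the cube: under the summability assumption of the theorem the
   series defining xi converges for |q s| <= 1 + eps, so this is the same as
   the one-sided derivative there. *)
Definition partial (R : realType) (S : finType) (f : (S -> R) -> R) (s : S)
    (q : S -> R) : R :=
  derive1 (fun t : R => f [eta q with s |-> t]) (q s).

Definition xi_s (R : realType) (S : finType) (lam : S -> R) (beta : nat -> R)
    (Delta2 : forall p : nat, p.-tuple S -> R) (s : S) (q : S -> R) : R :=
  (lam s)^-1 * partial (xi lam beta Delta2) s q.

Definition theta (R : realType) (S : finType) (lam : S -> R) (beta : nat -> R)
    (Delta2 : forall p : nat, p.-tuple S -> R) (q : S -> R) : R :=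
  \sum_(s : S) q s * partial (xi lam beta Delta2) s q - xi lam beta Delta2 q.

(* A map [0,1] -> [0,1]^S is represented by a total function R -> (S -> R) whose
   values outside [0,1] are irrelevant. *)
Definition admissible_map (R : realType) (S : finType) (lam : S -> R)
    (Phi : R -> S -> R) : Prop :=
  [/\ forall (q : R) (s : S), q \in `[0, 1] -> 0 <= Phi q s <= 1,
      forall s : S, {within `[0, 1], continuous (fun q : R => Phi q s)},
      forall s : S, {in `[0, 1] &, {homo (fun q : R => Phi q s) : x y / x <= y}}
    & forall q : R, q \in `[0, 1] -> \sum_(s : S) lam s * Phi q s = q].

(* A Borel probability measure on [0,1] is a Borel probability measure on the
   line that gives mass 1 to [0,1]. *)
Definition admissible_pair (R : realType) (S : finType) (lam : S -> R)
    (zeta : probability (measurableTypeR R) R) (Phi : R -> S -> R) : Prop :=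
  zeta `[0, 1]%classic = 1%E /\ admissible_map lam Phi.

(* In the integrals below, derive1 takes a default value at the points of the
   Lebesgue-null set where the composition with Phi is not derivable (and at the
   endpoints 0 and 1, where it depends on the irrelevant values of Phi). *)

Definition d_s (R : realType) (S : finType) (lam : S -> R) (beta : nat -> R)
    (Delta2 : forall p : nat, p.-tuple S -> R)
    (zeta : probability (measurableTypeR R) R) (Phi : R -> S -> R)
    (s : S) (q : R) : R :=
  \int[lebesgue_measure]_(u in `[q, 1])
    (fine (zeta `[0, u]%classic) * derive1 (xi_s lam beta Delta2 s \o Phi) u).

Definition parisi_A (R : realType) (S : finType) (lam : S -> R)
    (beta : nat -> R) (Delta2 : forall p : nat, p.-tuple S -> R)
    (zeta : probability (measurableTypeR R) R) (Phi : R -> S -> R)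
    (b : S -> R) : R :=
  \sum_(s : S) lam s / 2 *
    (b s - 1 - ln (b s)
     + xi_s lam beta Delta2 s (fun=> 0)
         / (b s - d_s lam beta Delta2 zeta Phi s 0)
     + \int[lebesgue_measure]_(q in `[0, 1])
         (derive1 (xi_s lam beta Delta2 s \o Phi) q
            / (b s - d_s lam beta Delta2 zeta Phi s q)))
  - 2^-1 * \int[lebesgue_measure]_(q in `[0, 1])
             (fine (zeta `[0, q]%classic) * derive1 (theta lam beta Delta2 \o Phi) q).

(* The infimum is taken in the extended reals, so no lower bound has to be
   established for it to be meaningful. *)
Definition parisi (R : realType) (S : finType) (lam : S -> R)
    (beta : nat -> R) (Delta2 : forall p : nat, p.-tuple S -> R)
    (zeta : probability (measurableTypeR R) R) (Phi : R -> S -> R) : \bar R :=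
  ereal_inf [set (parisi_A lam beta Delta2 zeta Phi b)%:E | b in
    [set b : S -> R | forall s : S,
       0 < b s /\ d_s lam beta Delta2 zeta Phi s 0 < b s]].

(* Main.v *)
Require Import Defs.
From HB Require Import structures.
From mathcomp Require Import all_boot all_order all_algebra.
From mathcomp Require Import all_classical all_reals all_analysis.
From mathcomp Require Import measurable_realfun.
From mathcomp Require Import lra ring.

(** The theorem is an instance of the direct method: a minimizing sequence of
triples (zeta, Phi, b) stays in a compact set on which the functional A is
continuous, so a limit point is a minimizer.

Compactness.  The maps Phi are monotone with sum_s lam s * Phi s q = q, hence
uniformly Lipschitz, and zeta enters only through the monotone function
u |-> zeta [0, u].  Limits are taken along an ultrafilter on the indices, where
every bounded sequence converges: this gives pointwise limits of all the data
at once, without extracting subsequences.  The limit of the distribution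
functions need not be right-continuous; its right regularization is the
distribution function of the limit measure
([right_regularization_measure]).

The levels b s are controlled by a logarithmic barrier.  Write h for the path
(xi_s \o Phi) and d q for the integral of zeta [0, u] h'(u) over [q, 1].  Since
zeta [0, u] <= 1, the increments of h dominate those of - d, so
  int h' / (b - d)  >=  int (- d') / (b - d)  =  ln b - ln (b - d 0),
and the term of A for one species is at least b - 1 - ln (b - d 0)
([log_barrier], [species_term_ge]).  This quantity is nonnegative, and a bound
on it bounds b from above and b - d 0 away from 0 ([entropy_bounds]).

Continuity.  Every integral in A has the form int g h' with g monotone and
bounded, h nondecreasing and Lipschitz on [0, 1].  Its Riemann sums
sum_i g (x_i) (h (x_(i+1)) - h (x_i)) approximate it with an error that depends
only on the mesh, the bound of g and the Lipschitz constant of h, and each of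
them is continuous under pointwise convergence of g and h.  Hence so is the
integral ([stieltjes_cvg]), and replacing the pointwise limit of g by its right
regularization does not change it.  No convergence of the derivatives h' is
involved.

Two ingredients make the previous paragraph meaningful.  The fundamental
theorem of calculus for monotone Lipschitz functions ([mono_lip01_FTC]) holds
because the Stieltjes measure of such a function is dominated by Lebesgue
measure, so that it has a density, equal almost everywhere to the derivative
by the differentiation theorem.  And the functions xi_s and theta are
nonnegative, nondecreasing and Lipschitz on the cube ([tame_partial],
[tame_theta]), because they are sums of power series with nonnegative
coefficients whose radius of convergence exceeds 1. *)

Set Implicit Arguments.
Unset Strict Implicit.
Unset Printing Implicit Defensive.
Import Order.TTheory GRing.Theory Num.Theory.
Import numFieldNormedType.Exports.
Local Open Scope classical_set_scope.
Local Open Scope ring_scope.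

(** * Integrals of functions modified on a null set *)

Section ae_nonmeasurable.
Local Open Scope ereal_scope.
Context d (T : measurableType d) (R : realType) (mu : {measure set T -> \bar R}).
Import HBNNSimple.

(** The function f, in practice a derivative with default values, need not be
measurable: its integral is still a supremum over the simple functions below
it, and those can be compared with g off the null set. *)
Lemma ge0_integral_eq_off_null (N : set T) (f g : T -> \bar R) :
  measurable N -> mu N = 0 -> measurable_fun [set: T] g ->
  (forall x, 0 <= f x) -> (forall x, 0 <= g x) ->
  (forall x, ~ N x -> f x = g x) ->
  \int[mu]_x f x = \int[mu]_x g x.
Proof.
move=> mN N0 mg f0 g0 fg.
have offN (u v : T -> \bar R) : measurable_fun [set: T] u -> measurable_fun [set: T] v ->
    (forall x, 0 <= u x) -> (forall x, 0 <= v x) ->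
    (forall x, ~ N x -> u x <= v x) -> \int[mu]_x u x <= \int[mu]_x v x.
  move=> mu_ mv u0 v0 uv.
  rewrite (ge0_negligible_integral mN)// [leRHS](ge0_negligible_integral mN)//.
  apply: ge0_le_integral => //; first exact: measurableD.
  - exact: measurable_funTS.
  - exact: measurable_funTS.
  - by move=> x [_]; exact: uv.
apply/eqP; rewrite eq_le; apply/andP; split.
  rewrite (ge0_integralTE _ f0); apply: ge_ereal_sup => _ [h hf <-].
  rewrite -(integralT_nnsfun mu h); apply: offN => //.
  - exact/measurable_EFinP.
  - by move=> x; rewrite lee_fin.
  - by move=> x Nx; rewrite -fg.
pose g' := g \_ (~` N).
have g'0 x : 0 <= g' x by rewrite /g' patchE; case: ifP.
have mg' : measurable_fun [set: T] g'.
  apply/(measurable_restrictT _ _).1 => //; first exact: measurableC.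
  exact: measurable_funTS.
apply: (@le_trans _ _ (\int[mu]_x g' x)).
  by apply: offN => // x Nx; rewrite /g' patchE mem_set.
rewrite (ge0_integralTE _ g'0) (ge0_integralTE _ f0).
apply: le_ereal_sup => _ [h hf <-]; exists h => //= x.
rewrite (le_trans (hf x))// /g' patchE; case: ifPn => //.
by rewrite inE /= => Nx; rewrite fg.
Qed.

Lemma integral_eq_off_null (D N : set T) (f g : T -> \bar R) :
  measurable D -> measurable N -> mu N = 0 -> measurable_fun D g ->
  (forall x, D x -> ~ N x -> f x = g x) ->
  \int[mu]_(x in D) f x = \int[mu]_(x in D) g x.
Proof.
move=> mD mN N0 mg fg.
rewrite integral_mkcond [RHS]integral_mkcond.
have mgD : measurable_fun [set: T] (g \_ D) by exact/(measurable_restrictT _ _).1.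
have fgD x : ~ N x -> (f \_ D) x = (g \_ D) x.
  by move=> Nx; rewrite !patchE; case: ifPn => // /set_mem Dx; exact: fg.
rewrite integralE [RHS]integralE; congr (_ - _).
  apply: (ge0_integral_eq_off_null mN) => //; first exact: measurable_funepos.
  by move=> x Nx; rewrite !funeposE fgD.
apply: (ge0_integral_eq_off_null mN) => //; first exact: measurable_funeneg.
by move=> x Nx; rewrite !funenegE fgD.
Qed.

End ae_nonmeasurable.

(** * Densities of Stieltjes measures of monotone Lipschitz functions *)

Section absolutely_continuous_stieltjes.
Context (R : realType).

(** Monotonicity and the Lipschitz bound are kept in a single inequality, since
they are always used together: H and x |-> L * x - H x are then both
nondecreasing. *)
Definition mono_lip (L : R) (H : R -> R) :=
  forall x y, x <= y -> 0 <= H y - H x <= L * (y - x).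

Lemma mono_lip_ge0 (L : R) (H : R -> R) : mono_lip L H -> 0 <= L.
Proof.
by move=> HL; have := HL 0 1 ler01; rewrite subr0 mulr1 => /andP[/le_trans]; apply.
Qed.

Lemma mono_lip_nd (L : R) (H : R -> R) : mono_lip L H -> {homo H : x y / x <= y}.
Proof. by move=> HL x y /HL/andP[]; rewrite subr_ge0. Qed.

Lemma mono_lip_continuous (L : R) (H : R -> R) : mono_lip L H -> continuous H.
Proof.
move=> HL x; apply/cvgrPdist_le => /= e e0.
have L0 := mono_lip_ge0 HL.
near=> y.
have : `|x - y| <= e / (L + 1).
  near: y; apply: cvgr_dist_le => //; rewrite divr_gt0//; lra.
rewrite ler_pdivlMr; last lra.
move=> xy; apply: le_trans xy.
have aux u v : u <= v -> `|H u - H v| <= `|u - v| * (L + 1).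
  move=> uv; have /andP[h1 h2] := HL _ _ uv.
  rewrite distrC ger0_norm// distrC ger0_norm ?subr_ge0//; nra.
have [/aux//|/ltW/aux] := leP x y.
by rewrite distrC [in leRHS]distrC.
Unshelve. all: by end_near. Qed.

Lemma mono_lip_rc (L : R) (H : R -> R) : mono_lip L H -> right_continuous H.
Proof. by move=> /mono_lip_continuous HL; apply: right_continuousW. Qed.

Section dominated.
Variables (L : R) (H : R -> R) (HL : mono_lip L H).

Let K x := L * x - H x.
Let KL : mono_lip L K.
Proof. by move=> x y /HL; rewrite /K; lra. Qed.
Let lin x := L * x.
Let linL : mono_lip L lin.
Proof. by move=> x y xy; have := mono_lip_ge0 HL; rewrite /lin => L0; nra. Qed.

#[local] HB.instance Definition _ :=
  isCumulative.Build R _ R H (mono_lip_nd HL) (mono_lip_rc HL).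
#[local] HB.instance Definition _ :=
  isCumulative.Build R _ R K (mono_lip_nd KL) (mono_lip_rc KL).
#[local] HB.instance Definition _ :=
  isCumulative.Build R _ R lin (mono_lip_nd linL) (mono_lip_rc linL).

Let muH := lebesgue_stieltjes_measure H.
Let muK := lebesgue_stieltjes_measure K.
Let mulin := lebesgue_stieltjes_measure lin.

Let mu_ocitv (f : cumulative R R) a b : a <= b ->
  lebesgue_stieltjes_measure f `]a, b]%classic = (f b - f a)%:E.
Proof.
move=> ab; rewrite /lebesgue_stieltjes_measure /measure_extension/=.
by rewrite measurable_mu_extE/= ?wlength_itv_bnd//; exact: is_ocitv.
Qed.

Let addm := measure_add [the measure _ _ of muH] [the measure _ _ of muK].

Let addmE A : addm A = (muH A + muK A)%E.
Proof. exact: measure_addE. Qed.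

Let mulin_add A : measurable A -> mulin A = addm A.
Proof.
apply: lebesgue_stieltjes_measure_unique => _ [[a b]] /= _ <-.
have [ab|ba] := leP a b; last first.
  by rewrite set_itv_ge ?measure0// bnd_simp -leNgt ltW.
apply: etrans (esym (addmE `]a, b]%classic)).
rewrite /muH /muK !mu_ocitv// -EFinD; congr EFin.
by rewrite /= /lin /K; lra.
Qed.

Let mulin_scale A : measurable A ->
  mulin A = mscale (NngNum (mono_lip_ge0 HL)) (@lebesgue_measure R) A.
Proof.
apply: lebesgue_stieltjes_measure_unique => _ [[a b]] /= _ <-.
have [ab|ba] := leP a b; last first.
  by rewrite set_itv_ge ?measure0// bnd_simp -leNgt ltW.
have muid : lebesgue_measure `]a, b]%classic = (b - a)%:E.
  exact: (mu_ocitv idfun).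
apply: (@etrans _ _ (L%:E * lebesgue_measure `]a, b]%classic)%E) => //.
rewrite muid /mulin mu_ocitv// -EFinM; congr EFin.
by rewrite /= /lin; lra.
Qed.

Let muH0 A : measurable A -> lebesgue_measure A = 0%E -> muH A = 0%E.
Proof.
move=> mA A0; have := mulin_add mA; rewrite mulin_scale// /mscale/= A0 mule0.
rewrite addmE => /esym/eqP; rewrite padde_eq0 ?measure_ge0//.
by case/andP => /eqP.
Qed.

(** The Stieltjes measures of H and of x |-> L * x - H x add up to L times
Lebesgue measure, so the former is dominated by Lebesgue measure and has a
Radon-Nikodym density.  The measure is restricted to a bounded interval that
contains [0, 1] in its interior, to make it finite. *)
Lemma mono_lip_density : exists phi : R -> R,
  [/\ measurable_fun [set: R] phi, forall x, 0 <= phi x,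
   lebesgue_measure.-integrable [set: R] (EFin \o phi) &
   forall a b, -1 <= a -> a <= b -> b <= 2 ->
     (\int[lebesgue_measure]_(x in `]a, b]) (phi x)%:E)%E = (H b - H a)%:E].
Proof.
pose D : set (measurableTypeR R) := [set` `](-1 : R), 2]].
have mD : measurable D by exact: measurable_itv.
have fD : (muH D < +oo)%E.
  by rewrite /muH mu_ocitv ?ltry//; lra.
pose nu : {finite_measure set (measurableTypeR R) -> \bar R} := mfrestr mD fD.
have nudom : nu `<< (@lebesgue_measure R).
  apply/null_content_dominatesP => A mA A0.
  apply: muH0; first exact: measurableI.
  apply: (subset_measure0 _ _ _ A0) => //.
  exact: measurableI.
pose f := Radon_Nikodym_SigmaFinite.f nu (@lebesgue_measure R).
have f0 := Radon_Nikodym_SigmaFinite.f_ge0 nudom.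
have ff := Radon_Nikodym_SigmaFinite.f_fin_num nudom.
have fi := Radon_Nikodym_SigmaFinite.f_integrable nudom.
have fE : EFin \o (fine \o f) = f.
  by apply/funext => x /=; rewrite fineK//; exact: ff.
exists (fine \o f); split.
- by apply/measurable_EFinP; rewrite fE; exact: (measurable_int lebesgue_measure).
- by move=> x /=; rewrite fine_ge0//; exact: f0.
- by rewrite fE.
- move=> a b a1 ab b2.
  rewrite -[X in integral _ _ X]/(EFin \o (fine \o f)) fE.
  rewrite -(Radon_Nikodym_SigmaFinite.f_integral nudom)//.
  rewrite /nu /= /mfrestr /mrestr.
  rewrite setIidl; last first.
    have sub (y : R) : a < y <= b -> -1 < y <= 2 by lra.
    by move=> x; exact: sub.
  by rewrite /muH mu_ocitv.
Qed.

End dominated.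
End absolutely_continuous_stieltjes.

(** * Fundamental theorem of calculus on the unit interval *)

Section lipschitz_on_the_unit_interval.
Context (R : realType).
Implicit Types (L : R) (g h : R -> R).

Definition mono_lip01 L h := forall x y, 0 <= x -> x <= y -> y <= 1 ->
  0 <= h y - h x <= L * (y - x).

Definition clamp (x : R) : R := if x <= 0 then 0 else if x <= 1 then x else 1.

Lemma clamp_ge0 x : 0 <= clamp x.
Proof. by rewrite /clamp; case: (leP x 0) => // ?; case: (leP x 1) => // ?; lra. Qed.

Lemma clamp_le1 x : clamp x <= 1.
Proof. by rewrite /clamp; case: (leP x 0) => // ?; case: (leP x 1) => // ?; lra. Qed.

Lemma clampE x : 0 <= x <= 1 -> clamp x = x.
Proof. by rewrite /clamp; case: (leP x 0) => // ?; case: (leP x 1) => // ?; lra. Qed.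

Lemma clamp_lip x y : x <= y -> 0 <= clamp y - clamp x <= y - x.
Proof.
by rewrite /clamp; case: (leP x 0) => ?; case: (leP x 1) => ?;
  case: (leP y 0) => ?; case: (leP y 1) => ?; lra.
Qed.

Lemma mono_lip01_ge0 L h : mono_lip01 L h -> 0 <= L.
Proof.
by move=> /(_ 0 1 (lexx _) ler01 (lexx _)); rewrite subr0 mulr1 => /andP[/le_trans]; apply.
Qed.

Lemma mono_lip01_clamp L h : mono_lip01 L h -> mono_lip L (h \o clamp).
Proof.
move=> hL x y xy; have /andP[c1 c2] := clamp_lip xy.
have := hL _ _ (clamp_ge0 x) _ (clamp_le1 y); rewrite -subr_ge0 => /(_ c1) /andP[h1 h2].
by have := mono_lip01_ge0 hL; rewrite /= h1 /= => L0; apply: (le_trans h2); rewrite ler_wpM2l.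
Qed.

(** The density of the Stieltjes measure of h equals h' almost everywhere by the
Lebesgue differentiation theorem.  The endpoints belong to the exceptional set
N: the derivative there depends on the values of h outside [0, 1]. *)
Lemma mono_lip01_FTC L h : mono_lip01 L h -> exists (phi : R -> R) (N : set R),
  [/\ measurable_fun [set: R] phi, forall x, 0 <= phi x,
     lebesgue_measure.-integrable [set: R] (EFin \o phi),
     measurable N /\ lebesgue_measure N = 0%E &
     (forall x, 0 <= x <= 1 -> ~ N x -> derive1 h x = phi x) /\
     forall a b, 0 <= a -> a <= b -> b <= 1 ->
      (\int[lebesgue_measure]_(x in `[a, b]) (phi x)%:E)%E = (h b - h a)%:E].
Proof.
move=> hL; have [phi [mphi phi0 iphi phiE]] := mono_lip_density (mono_lip01_clamp hL).
have hphi a b : 0 <= a -> a <= b -> b <= 1 ->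
    (\int[lebesgue_measure]_(x in `]a, b]) (phi x)%:E)%E = (h b - h a)%:E.
  by move=> a0 ab b1; rewrite phiE /= ?clampE//; lra.
have iphiS y : lebesgue_measure.-integrable [set` Interval (BRight 0) (BRight y)] (EFin \o phi).
  exact: integrableS iphi.
have lphi : locally_integrable [set: R] phi.
  by apply: open_integrable_locally => //; exact: openT.
have [N [mN N0 NP]] := FTC1 iphiS lphi.
exists phi, (N `|` ([set 0] `|` [set 1])); split => //.
  split; first by do 2!apply: measurableU => //.
  have n1 (x : R) : lebesgue_measure [set x] = 0%E by exact: lebesgue_measure_set1.
  have n01 : lebesgue_measure ([set 0] `|` [set 1] : set R) = 0%E.
    have e := @measureU0 _ _ _ (@lebesgue_measure R) [set 0] [set 1]
      (measurable_set1 _) (measurable_set1 _) (n1 1).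
    exact: (etrans e (n1 0)).
  by rewrite measureU0 ?n01 ?N0//; exact: measurableU.
split; last first.
  move=> a b a0 ab b1; rewrite -hphi// -integral_itv_obnd_cbnd//.
  by apply/measurable_EFinP; exact: measurable_funTS.
move=> x x01 /not_orP[Nx /not_orP[x0 x1]].
have {x01 x0 x1} x01 : 0 < x < 1.
  by have := x01; rewrite !le_eqVlt => /andP[/predU1P[/esym//|->] /predU1P[//|->]].
pose F (y : R) : R :=
  \int[lebesgue_measure]_(t in [set` Interval (BRight 0) (BRight y)]) phi t.
have {Nx NP} [dF <-] : derivable F x 1 /\ F^`()%classic x = phi x.
  by apply: contrapT => Fx; apply: Nx; apply: NP => /= H; apply: Fx; apply: H; case/andP: x01.
have Fh : \forall y \near x, h y = (F + cst (h 0)) y.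
  have xo : x \in `]0, 1[ by rewrite in_itv.
  near=> y.
  have : y \in `]0, 1[ by near: y; exact: near_in_itvoo.
  rewrite in_itv/= => /andP[y0 y1].
  by rewrite /F fctE /= /Rintegral hphi//=; lra.
rewrite !derive1E (near_eq_derive (1 : R) Fh) deriveD//.
by rewrite derive_cst addr0.
Unshelve. all: by end_near. Qed.

End lipschitz_on_the_unit_interval.

(** * The integral of g against dh *)

Section integral_against_derivative.
Context (R : realType).
Implicit Types (L M : R) (g h : R -> R).

Definition nd01 g := forall x y, 0 <= x -> x <= y -> y <= 1 -> g x <= g y.
Definition range01 M g := forall x, 0 <= x <= 1 -> 0 <= g x <= M.

Definition bounded_meas01 g := measurable_fun `[(0 : R), 1]%classic g /\
  exists M, forall x, 0 <= x <= 1 -> `|g x| <= M.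

Lemma nd01_bounded_meas g : nd01 g -> bounded_meas01 g.
Proof.
move=> gnd; split.
  apply: (eq_measurable_fun (g \o clamp (R := R))).
    by move=> x; rewrite inE /= in_itv /= => x01; rewrite clampE.
  apply: nondecreasing_measurable => // x y xy /=.
  apply: gnd; [exact: clamp_ge0| |exact: clamp_le1].
  by have /andP[] := clamp_lip xy; rewrite subr_ge0.
exists (`|g 0| + `|g 1|) => x /andP[x0 x1].
have g0 := gnd _ _ (lexx _) x0 x1; have g1 := gnd _ _ x0 x1 (lexx _).
rewrite ler_norml; have := ler_norm (g 1); have := ler_norm (- g 0).
by rewrite normrN; have := normr_ge0 (g 0); have := normr_ge0 (g 1); lra.
Qed.

Lemma bounded_meas01N g : bounded_meas01 g -> bounded_meas01 (fun x => - g x).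
Proof.
by move=> [mg [M gM]]; split; [exact: measurable_funN|exists M => x /gM; rewrite normrN].
Qed.

Lemma bounded_meas01_cst (c : R) : bounded_meas01 (fun=> c).
Proof. by split; [exact: measurable_cst|exists `|c|]. Qed.

Lemma bounded_meas01D g1 g2 : bounded_meas01 g1 -> bounded_meas01 g2 ->
  bounded_meas01 (fun x => g1 x + g2 x).
Proof.
move=> [m1 [M1 h1]] [m2 [M2 h2]]; split; first exact: measurable_funD.
exists (M1 + M2) => x x01; apply: le_trans (ler_normD _ _) _.
by rewrite lerD ?h1 ?h2.
Qed.

(** For h monotone and Lipschitz, this is the Stieltjes integral of g against dh.
It is written with the total derivative, as are the integrals in the Parisi
functional. *)
Definition stieltjes g h a b :=
  \int[lebesgue_measure]_(u in `[a, b]) (g u * derive1 h u).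

(** The only access to the derivative: all properties of the integral are read
off the density phi, which is measurable and integrable. *)
Lemma stieltjes_density L h : mono_lip01 L h -> exists phi : R -> R,
  [/\ forall x, 0 <= phi x,
      forall a b, 0 <= a -> a <= b -> b <= 1 ->
        \int[lebesgue_measure]_(u in `[a, b]) phi u = h b - h a &
      forall g a b, bounded_meas01 g -> 0 <= a -> b <= 1 ->
        stieltjes g h a b = \int[lebesgue_measure]_(u in `[a, b]) (g u * phi u) /\
        lebesgue_measure.-integrable `[a, b] (EFin \o (fun u => g u * phi u))].
Proof.
move=> /mono_lip01_FTC[phi [N [mphi phi0 iphi [mN N0] [Nh phiE]]]].
exists phi; split => //.
  by move=> a b a0 ab b1; rewrite /Rintegral phiE.
move=> g a b [mg [M gM]] a0 b1.
have sub (x : R) : a <= x <= b -> 0 <= x <= 1 by lra.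
have mgab : measurable_fun `[a, b]%classic g.
  by apply: measurable_funS mg => // x; exact: sub.
split.
  rewrite /stieltjes /Rintegral; congr fine.
  apply: (@integral_eq_off_null _ _ _ lebesgue_measure `[a, b]%classic N
    (fun u => (g u * derive1 h u)%:E) (fun u => (g u * phi u)%:E)) => //.
    apply/measurable_EFinP; apply: measurable_funM => //.
    exact: measurable_funTS.
  by move=> x /= xab Nx; rewrite Nh//; exact: sub.
rewrite (_ : EFin \o _ = ((EFin \o g) \* (EFin \o phi))%E)//.
apply: integrableMr => //.
  exists M; split; first exact: num_real.
  move=> M' MM' x /= xab; apply: ltW; apply: le_lt_trans MM'.
  by apply: gM; exact: sub.
exact: integrableS iphi.
Qed.

Lemma stieltjes_cst L h (c a b : R) : mono_lip01 L h -> 0 <= a -> a <= b -> b <= 1 ->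
  stieltjes (fun=> c) h a b = c * (h b - h a).
Proof.
move=> /stieltjes_density[phi [phi0 phiE JE]] a0 ab b1.
have [-> _] := JE _ _ _ (bounded_meas01_cst c) a0 b1.
have [_] := JE _ _ _ (bounded_meas01_cst 1) a0 b1.
rewrite (_ : EFin \o _ = EFin \o phi); last by apply/funext => u /=; rewrite mul1r.
by move=> iphi; rewrite RintegralZl ?phiE.
Qed.

Lemma stieltjes_ge0 L h g (a b : R) : mono_lip01 L h -> bounded_meas01 g -> 0 <= a -> b <= 1 ->
  (forall x, a <= x <= b -> 0 <= g x) -> 0 <= stieltjes g h a b.
Proof.
move=> /stieltjes_density[phi [phi0 phiE JE]] gbm a0 b1 g0.
have [-> _] := JE _ _ _ gbm a0 b1.
by apply: Rintegral_ge0 => x /=; rewrite in_itv => xab; rewrite mulr_ge0 ?g0.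
Qed.

Lemma le_stieltjes L h g1 g2 (a b : R) : mono_lip01 L h ->
  bounded_meas01 g1 -> bounded_meas01 g2 -> 0 <= a -> b <= 1 ->
  (forall x, a <= x <= b -> g1 x <= g2 x) -> stieltjes g1 h a b <= stieltjes g2 h a b.
Proof.
move=> /stieltjes_density[phi [phi0 phiE JE]] gbm1 gbm2 a0 b1 g12.
have [-> i1] := JE _ _ _ gbm1 a0 b1.
have [-> i2] := JE _ _ _ gbm2 a0 b1.
by apply: le_Rintegral => // x /=; rewrite in_itv => xab; rewrite ler_wpM2r ?g12.
Qed.

Lemma stieltjes_cat L h g (a b c : R) : mono_lip01 L h -> bounded_meas01 g -> 0 <= a -> a <= b ->
  b <= c -> c <= 1 -> stieltjes g h a c = stieltjes g h a b + stieltjes g h b c.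
Proof.
move=> /stieltjes_density[phi [phi0 phiE JE]] gbm a0 ab bc c1.
have [-> iac] := JE g a c gbm a0 c1.
have [-> iab] := JE g a b gbm a0 (le_trans bc c1).
have [-> ibc] := JE g b c gbm (le_trans a0 ab) c1.
rewrite -(Rintegral_itv_obnd_cbnd (r := b)); last first.
  by apply: integrableS ibc => //; exact: subset_itv_oc_cc.
by rewrite -(Rintegral_itvB iac)// addrC subrK.
Qed.

Lemma stieltjes_subl L h g (M a b : R) : mono_lip01 L h -> bounded_meas01 g ->
  0 <= a -> a <= b -> b <= 1 ->
  stieltjes (fun x => M - g x) h a b = M * (h b - h a) - stieltjes g h a b.
Proof.
move=> hL gbm a0 ab b1.
have [phi [phi0 phiE JE]] := stieltjes_density hL.
have [-> i1] := JE _ _ _ (bounded_meas01D (bounded_meas01_cst M) (bounded_meas01N gbm)) a0 b1.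
have [-> i2] := JE _ _ _ gbm a0 b1.
have [e i3] := JE _ _ _ (bounded_meas01_cst M) a0 b1.
rewrite -(stieltjes_cst M hL)// e -RintegralB//; apply: eq_Rintegral => x _.
by rewrite mulrBl.
Qed.

End integral_against_derivative.

(** * Riemann sums and pointwise limits *)

Section riemann_sums.
Context (R : realType).
Implicit Types (L M : R) (g h : R -> R).

Definition mesh (a b : R) (n i : nat) : R := a + (b - a) * (i%:R / n.+1%:R).

(** The integrand is sampled at the left end of each cell for k = 0, and at the
right end for k = 1. *)
Definition riemann (k : nat) g h (a b : R) (n : nat) : R :=
  \sum_(0 <= i < n.+1) g (mesh a b n (k + i)) * (h (mesh a b n i.+1) - h (mesh a b n i)).

Lemma mesh0 a b n : mesh a b n 0 = a.
Proof. by rewrite /mesh mul0r mulr0 addr0. Qed.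

Lemma meshn a b n : mesh a b n n.+1 = b.
Proof. by rewrite /mesh divff ?pnatr_eq0// mulr1 addrC subrK. Qed.

Lemma meshS a b n i : mesh a b n i.+1 - mesh a b n i = (b - a) / n.+1%:R.
Proof. by rewrite /mesh opprD addrACA subrr add0r -mulrBr -mulrBl -natrB// subSnn mul1r. Qed.

Lemma le_mesh a b n i : a <= b -> mesh a b n i <= mesh a b n i.+1.
Proof. by move=> ab; rewrite -subr_ge0 meshS divr_ge0// subr_ge0. Qed.

Lemma mesh_itv a b n i : a <= b -> (i <= n.+1)%N -> a <= mesh a b n i <= b.
Proof.
move=> ab ilen; have r0 : 0 <= (i%:R / n.+1%:R : R) by rewrite divr_ge0.
have r1 : (i%:R / n.+1%:R : R) <= 1 by rewrite ler_pdivrMr// mul1r ler_nat.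
move: r0 r1; rewrite /mesh; set r := i%:R / _ => r0 r1; apply/andP; split; nra.
Qed.

Section bounds.
Variables (L M : R) (g h : R -> R) (a b : R) (n : nat).
Hypotheses (hL : mono_lip01 L h) (gnd : nd01 g) (gM : range01 M g).
Hypotheses (a0 : 0 <= a) (ab : a <= b) (b1 : b <= 1).

Let mesh01 i : (i <= n.+1)%N -> 0 <= mesh a b n i <= 1.
Proof. by move=> /(mesh_itv ab)/andP[p0 p1]; rewrite (le_trans a0 p0) (le_trans p1 b1). Qed.

Let dh i : (i < n.+1)%N ->
  0 <= h (mesh a b n i.+1) - h (mesh a b n i) <= L * ((b - a) / n.+1%:R).
Proof.
move=> i_n; have /andP[p0 _] := mesh01 (ltnW i_n).
have /andP[_ p1] := mesh01 i_n.
by have := hL p0 (le_mesh n i ab) p1; rewrite meshS.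
Qed.

Lemma stieltjes_sum : stieltjes g h a b =
  \sum_(0 <= i < n.+1) stieltjes g h (mesh a b n i) (mesh a b n i.+1).
Proof.
have gbm := nd01_bounded_meas gnd.
suff H k : (k <= n.+1)%N ->
    stieltjes g h a (mesh a b n k) =
    \sum_(0 <= i < k) stieltjes g h (mesh a b n i) (mesh a b n i.+1).
  by rewrite -H// meshn.
elim: k => [_|k IH kn].
  rewrite big_geq// mesh0.
  have := stieltjes_cat hL gbm a0 (lexx a) (lexx a) (le_trans ab b1); lra.
rewrite big_nat_recr//= -IH 1?ltnW//.
have /andP[p0 _] := mesh_itv ab (ltnW kn).
apply: (stieltjes_cat hL gbm) => //; first exact: le_mesh.
by have /andP[] := mesh01 kn.
Qed.

Lemma riemann_le_stieltjes : riemann 0 g h a b n <= stieltjes g h a b.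
Proof.
rewrite stieltjes_sum /riemann; apply: ler_sum_nat => i /andP[_ i_n]; rewrite add0n.
have /andP[p0 _] := mesh01 (ltnW i_n).
have /andP[_ p1] := mesh01 i_n.
rewrite -(stieltjes_cst _ hL p0 (le_mesh n i ab) p1).
apply: (le_stieltjes hL) => //; [exact: bounded_meas01_cst|exact: nd01_bounded_meas|].
by move=> x xp; apply: gnd; lra.
Qed.

Lemma stieltjes_le_riemann : stieltjes g h a b <= riemann 1 g h a b n.
Proof.
rewrite stieltjes_sum /riemann; apply: ler_sum_nat => i /andP[_ i_n]; rewrite add1n.
have /andP[p0 _] := mesh01 (ltnW i_n).
have /andP[_ p1] := mesh01 i_n.
rewrite -(stieltjes_cst _ hL p0 (le_mesh n i ab) p1).
apply: (le_stieltjes hL) => //; [exact: nd01_bounded_meas|exact: bounded_meas01_cst|].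
by move=> x xp; apply: gnd; lra.
Qed.

(** The increments of h are at most L times the mesh, and those of g telescope to
at most M: the gap is uniform over all such g and h. *)
Lemma riemann_gap : riemann 1 g h a b n <= riemann 0 g h a b n + L * M / n.+1%:R.
Proof.
rewrite -lerBlDl /riemann -sumrB.
apply: (@le_trans _ _ (\sum_(0 <= i < n.+1)
   (g (mesh a b n i.+1) - g (mesh a b n i)) * (L * ((b - a) / n.+1%:R)))).
  apply: ler_sum_nat => i /andP[_ i_n]; rewrite add1n add0n -mulrBl.
  have /andP[p0 _] := mesh01 (ltnW i_n).
  have /andP[_ p1] := mesh01 i_n.
  rewrite ler_wpM2l//; last by have /andP[] := dh i_n.
  by rewrite subr_ge0; exact: gnd (le_mesh n i ab) p1.
rewrite -mulr_suml telescope_sumr// mesh0 meshn.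
have L0 := mono_lip01_ge0 hL.
have r0 : 0 <= (n.+1%:R^-1 : R) by rewrite invr_ge0.
set r := n.+1%:R^-1 in r0 *.
rewrite [leLHS](_ : _ = L * r * ((g b - g a) * (b - a))); last by ring.
rewrite [leRHS](_ : _ = L * r * M); last by ring.
rewrite ler_wpM2l ?mulr_ge0//.
have gab := gnd a0 ab b1.
have /andP[_ gb1] : 0 <= g b <= M by apply: gM; rewrite (le_trans a0 ab).
have /andP[ga0 _] : 0 <= g a <= M by apply: gM; rewrite a0 (le_trans ab b1).
have [a0' b1'] := (a0, b1).
apply: (@le_trans _ _ ((g b - g a) * 1)); first by rewrite ler_wpM2l ?subr_ge0//; lra.
by rewrite mulr1; lra.
Qed.

End bounds.

Let squeeze (C e j jn rb rn rn1 rg rg1 rb1 : R) :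
  `|rb - rn| <= e / 2 -> 3 * C <= e / 2 ->
  rn <= jn -> jn <= rn1 -> rn1 <= rn + C ->
  rg <= j -> j <= rg1 -> rg1 <= rg + C ->
  rb1 <= rb + C -> rb <= rg -> rg <= rb1 -> `|j - jn| <= e.
Proof.
rewrite !ler_norml => /andP[a1 a2] C3 b1 b2 b3 c1 c2 c3 d1 d2 d3.
apply/andP; split.
  have {b2 b3} b : jn <= rn + C by exact: le_trans b3.
  have {c1 d2} c : rb <= j by exact: le_trans c1.
  by clear -a1 a2 C3 b c b1; lra.
have {c2 c3} c : j <= rg + C by exact: le_trans c3.
have {d1 d3} d : rg <= rb + C by exact: le_trans d1.
by clear -a1 a2 C3 b1 c d; lra.
Qed.

Section convergence.
Variables (F : set_system nat) (FF : ProperFilter F).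
Variables (L M : R) (g_ h_ : nat -> R -> R) (gb g h : R -> R).
Hypotheses (hL_ : forall n, mono_lip01 L (h_ n)) (gnd_ : forall n, nd01 (g_ n)).
Hypotheses (gM_ : forall n, range01 M (g_ n)).
Hypotheses (gcv : forall x : R, 0 <= x <= 1 -> g_ n x @[n --> F] --> gb x).
Hypotheses (hcv : forall x : R, 0 <= x <= 1 -> h_ n x @[n --> F] --> h x).

Lemma mono_lip01_cvg : mono_lip01 L h.
Proof.
move=> x y x0 xy y1.
have cv : h_ n y - h_ n x @[n --> F] --> h y - h x.
  by apply: cvgB; apply: hcv; lra.
apply/andP; split.
  by apply: (cvgr_to_ge cv); apply: nearW => n; have /andP[] := hL_ n x0 xy y1.
by apply: (cvgr_to_le cv); apply: nearW => n; have /andP[] := hL_ n x0 xy y1.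
Qed.

Lemma nd01_cvg : nd01 gb.
Proof.
move=> x y x0 xy y1.
have cv : g_ n y - g_ n x @[n --> F] --> gb y - gb x.
  by apply: cvgB; apply: gcv; lra.
rewrite -subr_ge0; apply: (cvgr_to_ge cv); apply: nearW => n.
by rewrite subr_ge0; exact: gnd_.
Qed.

Lemma range01_cvg : range01 M gb.
Proof.
move=> x x01; apply/andP; split.
  by apply: (cvgr_to_ge (gcv x01)); apply: nearW => n; have /andP[] := gM_ n x01.
by apply: (cvgr_to_le (gcv x01)); apply: nearW => n; have /andP[] := gM_ n x01.
Qed.

Hypotheses (gnd : nd01 g) (gM : range01 M g).
Hypotheses (gbg : forall x : R, 0 <= x <= 1 -> gb x <= g x).
Hypotheses (ggb : forall x y : R, 0 <= x -> x < y -> y <= 1 -> g x <= gb y).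

(** The Riemann sums of g_ n against h_ n converge for each fixed mesh, with an
error that is uniform in n.  The function g only has to lie between the
pointwise limit gb and its right limits: shifting the sampling point by one
cell then moves between the sums of g and those of gb. *)
Lemma stieltjes_cvg a b : 0 <= a -> a <= b -> b <= 1 ->
  stieltjes (g_ n) (h_ n) a b @[n --> F] --> stieltjes g h a b.
Proof.
move=> a0; rewrite le_eqVlt => /predU1P[<- a1|ab b1].
  have J0 g' h' : nd01 g' -> mono_lip01 L h' -> stieltjes g' h' a a = 0.
    move=> g'nd h'L.
    by have := stieltjes_cat h'L (nd01_bounded_meas g'nd) a0 (lexx a) (lexx a) a1; lra.
  rewrite (J0 _ _ gnd mono_lip01_cvg); under eq_fun do rewrite J0//.
  exact: cvg_cst.
have ab' := ltW ab.
have hL := mono_lip01_cvg; have gbnd := nd01_cvg; have gbM := range01_cvg.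
have LM0 : 0 <= L * M.
  rewrite mulr_ge0 ?(mono_lip01_ge0 hL)//.
  have a01 : 0 <= a <= 1 by lra.
  by have /andP[g0 g1] := gM a01; exact: le_trans g1.
apply/cvgrPdist_le => /= e e0.
(* The gap L M / (N + 1) between the two sums is paid three times: for the n-th
   pair, for g, and for gb. *)
have [N Ne] : exists N, 3 * (L * M) / N.+1%:R <= e / 2.
  pose t := 3 * (L * M) / (e / 2).
  exists (Num.bound t); rewrite ler_pdivrMr// [leRHS]mulrC -ler_pdivrMr ?divr_gt0//.
  have t0 : 0 <= t.
    by apply: divr_ge0; [apply: mulr_ge0|apply/ltW; rewrite divr_gt0].
  apply: ltW; apply: lt_trans (archi_boundP t0) _.
  by rewrite ltr_nat.
have mesh01 i : (i <= N.+1)%N -> 0 <= mesh a b N i <= 1.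
  by move=> /(mesh_itv ab')/andP[p0 p1]; rewrite (le_trans a0 p0) (le_trans p1 b1).
have Rcv : riemann 0 (g_ n) (h_ n) a b N @[n --> F] --> riemann 0 gb h a b N.
  rewrite /riemann; under eq_fun do rewrite big_mkord; rewrite big_mkord.
  apply: cvg_big => [|i _]; first exact: add_continuous.
  apply: cvgM; first by apply: gcv; apply: mesh01; rewrite add0n ltnW.
  by apply: cvgB; apply: hcv; apply: mesh01 => //; exact: ltnW.
move/cvgrPdist_le : Rcv => /(_ (e / 2)) /= Rcv.
near=> n.
have Rn : `|riemann 0 gb h a b N - riemann 0 (g_ n) (h_ n) a b N| <= e / 2.
  by near: n; apply: Rcv; rewrite divr_gt0.
have h1 := riemann_le_stieltjes N (hL_ n) (gnd_ n) a0 ab' b1.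
have h2 := stieltjes_le_riemann N (hL_ n) (gnd_ n) a0 ab' b1.
have h3 := riemann_gap N (hL_ n) (gnd_ n) (gM_ n) a0 ab' b1.
have k1 := riemann_le_stieltjes N hL gnd a0 ab' b1.
have k2 := stieltjes_le_riemann N hL gnd a0 ab' b1.
have k3 := riemann_gap N hL gnd gM a0 ab' b1.
have k4 := riemann_gap N hL gbnd gbM a0 ab' b1.
have dh i : (i < N.+1)%N -> 0 <= h (mesh a b N i.+1) - h (mesh a b N i).
  move=> iN; have /andP[p0 _] := mesh01 _ (ltnW iN).
  have /andP[_ p1] := mesh01 _ iN.
  by have /andP[] := hL _ _ p0 (le_mesh N i ab') p1.
have k5 : riemann 0 gb h a b N <= riemann 0 g h a b N.
  apply: ler_sum_nat => i /andP[_ iN].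
  by rewrite ler_wpM2r ?dh// gbg//; apply: mesh01; rewrite add0n ltnW.
have k6 : riemann 0 g h a b N <= riemann 1 gb h a b N.
  apply: ler_sum_nat => i /andP[_ iN]; rewrite ler_wpM2r ?dh//.
  have /andP[p0 _] := mesh01 _ (ltnW iN); have /andP[_ p1] := mesh01 _ iN.
  by apply: ggb => //; rewrite -subr_gt0 add1n add0n meshS divr_gt0 ?subr_gt0.
apply: (@squeeze (L * M / N.+1%:R) _ _ _ _ _ _ _ _ _ Rn _ h1 h2 h3 k1 k2 k3 k4 k5 k6).
by rewrite mulrA.
Unshelve. all: by end_near. Qed.

End convergence.

(** The nonincreasing case follows by passing to M - g. *)
Lemma stieltjes_cvg_ni (F : set_system nat) (FF : ProperFilter F) (L M : R)
    (g_ h_ : nat -> R -> R) (g h : R -> R) (a b : R) :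
  (forall n, mono_lip01 L (h_ n)) -> (forall n, nd01 (fun x => - g_ n x)) ->
  (forall n, range01 M (g_ n)) ->
  (forall x : R, 0 <= x <= 1 -> g_ n x @[n --> F] --> g x) ->
  (forall x : R, 0 <= x <= 1 -> h_ n x @[n --> F] --> h x) ->
  0 <= a -> a <= b -> b <= 1 ->
  stieltjes (g_ n) (h_ n) a b @[n --> F] --> stieltjes g h a b.
Proof.
move=> hL_ gni_ gM_ gcv hcv a0 ab b1.
have hL := mono_lip01_cvg FF hL_ hcv.
have gNcv x : 0 <= x <= 1 -> - g_ n x @[n --> F] --> - g x.
  by move=> x01; apply: cvgN; exact: gcv.
have gni := nd01_cvg FF gni_ gNcv.
have gM := range01_cvg FF gM_ gcv.
have JM g' h' : mono_lip01 L h' -> nd01 (fun x => - g' x) ->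
    stieltjes g' h' a b = M * (h' b - h' a) - stieltjes (fun x => M - g' x) h' a b.
  move=> h'L g'ni; rewrite (stieltjes_subl _ h'L)//; first by rewrite opprB addrC subrK.
  by have := bounded_meas01N (nd01_bounded_meas g'ni); under eq_fun do rewrite opprK.
rewrite (JM _ _ hL gni); under eq_fun do rewrite JM//.
have Mnd g' : nd01 (fun x => - g' x) -> nd01 (fun x => M - g' x).
  by move=> H x y x0 xy y1; rewrite lerD2l; exact: H.
have MM g' : range01 M g' -> range01 M (fun x => M - g' x).
  by move=> H x /H; lra.
apply: cvgB.
  by apply: cvgMr; apply: cvgB; apply: hcv; lra.
apply: (@stieltjes_cvg F FF L M _ _ (fun x => M - g x)) => //.
- by move=> n; exact: Mnd.
- by move=> n; exact: MM.
- by move=> x x01; apply: cvgB; [exact: cvg_cst|exact: gcv].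
- exact: Mnd.
- exact: MM.
- by move=> x y x0 xy y1; apply: Mnd => //; exact: ltW.
Qed.

End riemann_sums.

(** * A probability measure from a monotone function *)

Section limit_distribution.
Context (R : realType).
Variable X : R -> R.
Hypotheses (Xnd : nd01 X) (X01 : range01 1 X) (X1 : X 1 = 1).

(** X extended by 0 on the left and by X 1 = 1 on the right of [0, 1]. *)
Let G (v : R) : R := if v < 0 then 0 else X (clamp v).

Let G0 v : v < 0 -> G v = 0.
Proof. by rewrite /G => ->. Qed.

Let GE v : 0 <= v <= 1 -> G v = X v.
Proof. by move=> v01; rewrite /G clampE// ltNge; case/andP: v01 => ->. Qed.

Let G1 v : 1 <= v -> G v = 1.
Proof.
move=> v1; rewrite /G ltNge (le_trans ler01 v1)/= /clamp leNgt (lt_le_trans ltr01 v1)/=.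
by case: (leP v 1) => // v1'; rewrite (_ : v = 1)//; apply/eqP; rewrite eq_le v1 v1'.
Qed.

Let G_ge0 v : 0 <= G v.
Proof.
rewrite /G; case: (ltP v 0) => // _.
by have /andP[] := X01 (x := clamp v) (introT andP (conj (clamp_ge0 v) (clamp_le1 v))).
Qed.

Let Gnd u v : u <= v -> G u <= G v.
Proof.
move=> uv; have [u0|u0] := ltP u 0; first by rewrite (G0 u0) G_ge0.
rewrite /G ltNge u0 /= ltNge (le_trans u0 uv) /=.
apply: Xnd; [exact: clamp_ge0| |exact: clamp_le1].
by have /andP[] := clamp_lip uv; rewrite subr_ge0.
Qed.

Let A (u : R) : set R := [set G v | v in [set v | u < v]].
Let F (u : R) : R := inf (A u).

Let A_inf u : has_inf (A u).
Proof.
split; first by exists (G (u + 1)), (u + 1) => //=; rewrite ltrDl.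
by exists 0 => _ [v _ <-].
Qed.

Let F_le u v : u < v -> F u <= G v.
Proof. by move=> uv; apply: ge_inf; [have [] := A_inf u|exists v]. Qed.

Let le_F u c : (forall v, u < v -> c <= G v) -> c <= F u.
Proof. by move=> H; apply: lb_le_inf => [|_ [v /= uv <-]]; [have [] := A_inf u|exact: H]. Qed.

Let G_le_F u : G u <= F u.
Proof. by apply: le_F => v /ltW; exact: Gnd. Qed.

Let Fnd : {homo F : u v / u <= v}.
Proof. by move=> u v uv; apply: le_F => w vw; apply: F_le; exact: le_lt_trans vw. Qed.

Let Frc : right_continuous F.
Proof.
move=> u; apply/cvgrPdist_le => /= e e0.
have [_ [v /= uv <-] Gv] := inf_adherent e0 (A_inf u).
near=> w; rewrite distrC ger0_norm; last by rewrite subr_ge0 Fnd.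
rewrite lerBlDl; apply: le_trans (ltW Gv); apply: F_le.
by near: w; exact: nbhs_right_lt.
Unshelve. all: by end_near. Qed.

#[local] HB.instance Definition _ := isCumulative.Build R _ R F Fnd Frc.

Let FN u : u < 0 -> F u = 0.
Proof.
move=> u0; apply/eqP; rewrite eq_le le_F// andbT.
by rewrite -(@G0 (u / 2)) ?F_le//; lra.
Qed.

Let FP u : 1 <= u -> F u = 1.
Proof.
move=> u1; apply/eqP; rewrite eq_le; apply/andP; split.
  by rewrite -(@G1 (u + 1)) ?F_le//; lra.
by rewrite -(G1 u1) G_le_F.
Qed.

Let FNy : F @ -oo --> (0 : R).
Proof.
apply: cvg_near_cst; near=> u; apply: FN.
by near: u; exact: nbhs_ninfty_lt.
Unshelve. all: by end_near. Qed.

Let Fy : F @ +oo --> (1 : R).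
Proof.
apply: cvg_near_cst; near=> u; apply: FP.
by near: u; exact: nbhs_pinfty_ge.
Unshelve. all: by end_near. Qed.

#[local] HB.instance Definition _ := isCumulativeBounded.Build R 0 1 F FNy Fy.

(** The infimum F of G over the right neighbours is a distribution function, and
the measure on the line with distribution function F is carried by [0, 1]
because F vanishes on the left of 0 and is 1 from 1 on. *)
Lemma right_regularization_measure : exists zeta : probability (measurableTypeR R) R,
  [/\ zeta `[0, 1]%classic = 1%E,
   forall x, 0 <= x <= 1 -> X x <= fine (zeta `[0, x]%classic) &
   forall x y, 0 <= x -> x < y -> y <= 1 -> fine (zeta `[0, x]%classic) <= X y].
Proof.
pose zeta : probability (measurableTypeR R) R := lebesgue_stieltjes_measure F.
have zetaE (r : R) : zeta `]-oo, r]%classic = (F r)%:E.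
  by rewrite -(cdf_lebesgue_stieltjes_id F).
have zeta0 : zeta `]-oo, 0[%classic = 0%E.
  have -> : `]-oo, 0[%classic = \bigcup_n `]-oo, (- n.+1%:R^-1 : R)]%classic.
    apply/seteqP; split => [x /=|x [n _] /=]; rewrite !in_itv/=; last first.
      by move=> /le_lt_trans; apply; rewrite oppr_lt0 invr_gt0.
    move=> x0; exists (Num.bound (- x)^-1) => //=; rewrite in_itv/=.
    rewrite lerNr invf_ple ?posrE ?oppr_gt0//.
    have xi0 : 0 <= (- x)^-1 by rewrite invr_ge0 oppr_ge0 ltW.
    by apply: ltW; apply: lt_trans (archi_boundP xi0) _; rewrite ltr_nat.
  apply/(negligibleP zeta); first exact: bigcup_measurable.
  apply: negligible_bigcup => n; apply/(negligibleP zeta) => //.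
  by apply: etrans (zetaE _) _; rewrite FN// oppr_lt0 invr_gt0.
have zeta0x (x : R) : 0 <= x -> zeta `[0, x]%classic = (F x)%:E.
  move=> x0; rewrite -zetaE (@itv_bndbnd_setU _ _ -oo%O (BLeft 0))//.
  have d : `]-oo, 0[%classic `&` `[0, x]%classic = set0.
    apply/seteqP; split => // y [] /=; rewrite !in_itv/= => y0 /andP[].
    by rewrite leNgt y0.
  have := measureU zeta (measurable_itv `]-oo, 0[) (measurable_itv `[0, x]) d.
  move=> e; apply: esym; apply: (etrans e).
  by apply: etrans (congr1 (fun t => t + _)%E zeta0) _; rewrite add0e.
exists zeta; split.
- by rewrite zeta0x// FP.
- by move=> x x01; rewrite zeta0x/= -?GE//; case/andP: x01.
- move=> x y x0 xy y1; rewrite zeta0x//= -GE ?F_le// (le_trans x0 (ltW xy))//.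
Qed.

End limit_distribution.

(** * Dominated series *)

Section dominated_series.
Context (R : realType).
Variables (a : nat -> R) (B : R).
Hypothesis a_ge0 : forall p, (0 < p)%N -> 0 <= a p.
Hypothesis aB : forall N, \sum_(1 <= p < N) a p <= B.

Definition tsum (u : nat -> R) : R := limn (fun N => \sum_(1 <= p < N) u p).

(** The sequence a is a fixed summable majorant; the constant K is kept explicit
because the Lipschitz and Taylor estimates are read off it. *)
Definition dominated (K : R) (u : nat -> R) := forall p, (0 < p)%N -> `|u p| <= K * a p.

Let psum_nd (u : nat -> R) : (forall p, (0 < p)%N -> 0 <= u p) ->
  nondecreasing_seq (fun N => \sum_(1 <= p < N) u p).
Proof.
move=> u0; apply/nondecreasing_seqP => -[|N]; first by rewrite !big_geq.
by rewrite [leRHS]big_nat_recr//= lerDl u0.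
Qed.

Lemma dominated_ge0 K u : dominated K u -> forall p, (0 < p)%N -> 0 <= K * a p.
Proof. by move=> uK p /uK; exact: le_trans. Qed.

Let psumK K N : \sum_(1 <= p < N) (K * a p) = K * \sum_(1 <= p < N) a p.
Proof. by rewrite mulr_sumr. Qed.

(** Both u + K a and K a have nonnegative terms and bounded partial sums. *)
Lemma cvg_tsum K u : dominated K u ->
  (fun N => \sum_(1 <= p < N) u p) @ \oo --> tsum u.
Proof.
move=> uK.
have KK := dominated_ge0 uK.
suff : cvgn (fun N => \sum_(1 <= p < N) u p) by [].
have Kb N : \sum_(1 <= p < N) (K * a p) <= `|K| * B.
  rewrite psumK; apply: (@le_trans _ _ (`|K| * \sum_(1 <= p < N) a p)).
    by rewrite ler_wpM2r ?ler_norm// big_nat_cond sumr_ge0// => p /andP[/andP[/a_ge0]].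
  by rewrite ler_wpM2l.
have c1 : cvgn (fun N => \sum_(1 <= p < N) (u p + K * a p)).
  apply: nondecreasing_is_cvgn.
    by apply: psum_nd => p p0; have := uK p p0; rewrite ler_norml => /andP[]; lra.
  exists (`|K| * B + `|K| * B) => _ [N _ <-]; rewrite big_split/= lerD//.
  apply: le_trans (Kb N); rewrite !big_nat; apply: ler_sum => p /andP[p0 _].
  by apply: le_trans (uK p p0); exact: ler_norm.
have c2 : cvgn (fun N => \sum_(1 <= p < N) (K * a p)).
  apply: nondecreasing_is_cvgn; first by apply: psum_nd => p /KK.
  by exists (`|K| * B) => _ [N _ <-].
rewrite (_ : (fun N => _) = (fun N => \sum_(1 <= p < N) (u p + K * a p)) \-
                            (fun N => \sum_(1 <= p < N) (K * a p))).
  exact: is_cvgB.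
by apply/funext => N /=; rewrite big_split/= addrK.
Qed.

Lemma tsumZ c K u : dominated K u -> tsum (fun p => c * u p) = c * tsum u.
Proof.
move=> /cvg_tsum cu; apply/cvg_lim => //.
under eq_fun do rewrite -mulr_sumr.
exact: cvgMr.
Qed.

Lemma dominatedZ c K u : dominated K u -> dominated (`|c| * K) (fun p => c * u p).
Proof. by move=> uK p p0; rewrite normrM -mulrA ler_wpM2l// uK. Qed.

Lemma dominatedB K1 K2 u v : dominated K1 u -> dominated K2 v ->
  dominated (K1 + K2) (fun p => u p - v p).
Proof.
by move=> uK vK p p0; rewrite mulrDl (le_trans (ler_normB _ _))// lerD ?uK ?vK.
Qed.

Lemma tsumB K1 K2 u v : dominated K1 u -> dominated K2 v ->
  tsum (fun p => u p - v p) = tsum u - tsum v.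
Proof.
move=> /cvg_tsum cu /cvg_tsum cv; apply/cvg_lim => //.
under eq_fun do rewrite sumrB/=.
exact: cvgB.
Qed.

Lemma dominated_sum (I : finType) K (u : I -> nat -> R) : (forall i, dominated K (u i)) ->
  exists K', dominated K' (fun p => \sum_i u i p).
Proof.
move=> uK; exists (\sum_(i : I) K) => p p0.
rewrite mulr_suml (le_trans (ler_norm_sum _ _ _))//.
by apply: ler_sum => i _; exact: uK.
Qed.

Lemma tsum_sum (I : finType) K (u : I -> nat -> R) : (forall i, dominated K (u i)) ->
  tsum (fun p => \sum_i u i p) = \sum_i tsum (u i).
Proof.
move=> uK; apply/cvg_lim => //.
under eq_fun do rewrite exchange_big/=.
apply: cvg_big => [|i _]; first exact: add_continuous.
exact: cvg_tsum (uK i).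
Qed.

Lemma le_tsum K1 K2 u v : dominated K1 u -> dominated K2 v ->
  (forall p, (0 < p)%N -> u p <= v p) -> tsum u <= tsum v.
Proof.
move=> /cvg_tsum cu /cvg_tsum cv uv.
apply: (ler_cvg_to cu cv); apply: nearW => N.
by rewrite !big_nat; apply: ler_sum => p /andP[/uv].
Qed.

Lemma tsum_bound K u : 0 <= K -> dominated K u -> `|tsum u| <= K * B.
Proof.
move=> K0 uK; have cu := cvg_tsum uK.
have Nb N : `|\sum_(1 <= p < N) u p| <= K * B.
  apply: (@le_trans _ _ (\sum_(1 <= p < N) (K * a p))).
    rewrite (le_trans (ler_norm_sum _ _ _))// !big_nat.
    by apply: ler_sum => p /andP[/uK].
  by rewrite psumK ler_wpM2l.
rewrite ler_norml; apply/andP; split.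
  by apply: (cvgr_to_ge cu); apply: nearW => N; have := Nb N; rewrite ler_norml => /andP[].
by apply: (cvgr_to_le cu); apply: nearW => N; have := Nb N; rewrite ler_norml => /andP[].
Qed.

End dominated_series.

(** * Monomials and their partial derivatives *)

Section monomials.
Context (R : realType) (S : finType).
Implicit Types (q : S -> R) (l : seq S) (s : S).

(** Lists replace tuples so that the estimates can be proved by induction on the
degree. *)
Definition smon q l : R := \prod_(x <- l) q x.

(** The partial derivative of the monomial in the variable s, by the Leibniz rule
along the list. *)
Fixpoint dmon s q l : R :=
  if l is x :: l' then (x == s)%:R * smon q l' + q x * dmon s q l' else 0.

Lemma monE q p (t : p.-tuple S) : mon q t = smon q t.
Proof. by rewrite /mon /smon big_tuple. Qed.

Lemma smon_cons q x l : smon q (x :: l) = q x * smon q l.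
Proof. by rewrite /smon big_cons. Qed.

Definition cube q := forall s, 0 <= q s <= 1.
Definition ldist q q' : R := \sum_s `|q s - q' s|.

Lemma ldist_ge q q' s : `|q s - q' s| <= ldist q q'.
Proof. by rewrite /ldist (bigD1 s)//= lerDl sumr_ge0. Qed.

Lemma ldist_ge0 q q' : 0 <= ldist q q'.
Proof. by rewrite sumr_ge0. Qed.

Lemma smon_norm q l (rho : R) : 1 <= rho -> (forall s, `|q s| <= rho) ->
  `|smon q l| <= rho ^+ size l.
Proof.
move=> rho1 qrho; elim: l => [|x l IH]; first by rewrite /smon big_nil normr1 expr0.
by rewrite smon_cons normrM exprS ler_pM.
Qed.

Lemma smon01 q l : cube q -> 0 <= smon q l <= 1.
Proof.
move=> q01; apply/andP; split.
  by apply: prodr_ge0 => x _; have /andP[] := q01 x.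
have := @smon_norm q l 1 (lexx _); rewrite expr1n => H; apply: le_trans (ler_norm _) (H _).
by move=> s; have /andP[q0 q1] := q01 s; rewrite ger0_norm.
Qed.

Lemma dmon_norm s q l (rho : R) : 1 <= rho -> (forall s, `|q s| <= rho) ->
  `|dmon s q l| <= (size l)%:R * rho ^+ size l.
Proof.
move=> rho1 qrho; elim: l => [|x l IH]; first by rewrite /= normr0 mul0r.
have r0 : 0 <= rho by apply: le_trans rho1.
have re : 0 <= rho ^+ size l by rewrite exprn_ge0.
rewrite /= exprS -natr1 mulrDl mul1r addrC (le_trans (ler_normD _ _))// lerD//.
  by rewrite normrM [leRHS]mulrCA ler_pM.
rewrite normrM normr_nat ler_pM ?smon_norm//.
by rewrite (le_trans _ rho1)//; case: (x == s).
Qed.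

Lemma dmon_ge0 s q l : cube q -> 0 <= dmon s q l.
Proof.
move=> q01; elim: l => [|x l IH] //=.
have /andP[m0 _] := smon01 l q01; have /andP[q0 _] := q01 x.
by rewrite addr_ge0// mulr_ge0.
Qed.

Lemma dmon_le s q l : cube q -> dmon s q l <= (size l)%:R.
Proof.
move=> q01; have := @dmon_norm s q l 1 (lexx _); rewrite expr1n mulr1 => H.
apply: le_trans (ler_norm _) (H _).
by move=> s'; have /andP[q0 q1] := q01 s'; rewrite ger0_norm.
Qed.

Lemma le_smon q q' l : cube q -> cube q' -> (forall s, q s <= q' s) ->
  smon q l <= smon q' l.
Proof.
move=> q01 q'01 qq'; elim: l => [|x l IH]; first by rewrite /smon !big_nil.
have /andP[m0 _] := smon01 l q01; have /andP[q0 _] := q01 x.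
by rewrite !smon_cons ler_pM.
Qed.

Lemma le_dmon s q q' l : cube q -> cube q' -> (forall s, q s <= q' s) ->
  dmon s q l <= dmon s q' l.
Proof.
move=> q01 q'01 qq'; elim: l => [|x l IH] //=.
have /andP[q0 _] := q01 x.
rewrite lerD//; first by rewrite ler_wpM2l// le_smon.
by rewrite ler_pM// dmon_ge0.
Qed.

Lemma smon_lip q q' l : cube q -> cube q' ->
  `|smon q l - smon q' l| <= (size l)%:R * ldist q q'.
Proof.
move=> q01 q'01; elim: l => [|x l IH].
  by rewrite /smon !big_nil subrr normr0 mul0r.
rewrite !smon_cons /= -natr1 mulrDl mul1r.
rewrite (_ : _ - _ = q x * (smon q l - smon q' l) + (q x - q' x) * smon q' l); last by ring.
rewrite (le_trans (ler_normD _ _))// lerD//.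
  have /andP[q0 q1] := q01 x.
  rewrite normrM (ger0_norm q0); apply: le_trans IH.
  by rewrite ler_piMl.
have /andP[m0 m1] := smon01 l q'01.
rewrite normrM (ger0_norm m0); apply: le_trans (ldist_ge _ _ x).
by rewrite ler_piMr.
Qed.

(** By induction on the list, one more factor costs at most 2 n + 1 times the
distance, which is the increment of the squares. *)
Lemma dmon_lip s q q' l : cube q -> cube q' ->
  `|dmon s q l - dmon s q' l| <= (size l)%:R ^+ 2 * ldist q q'.
Proof.
move=> q01 q'01; elim: l => [|x l IH] /=.
  by rewrite subrr normr0 mulr_ge0 ?ldist_ge0.
have ld0 := ldist_ge0 q q'.
set e : R := (x == s)%:R; set n := (size l)%:R in IH *.
have e1 : 0 <= e <= 1 by rewrite /e; case: (x == s); rewrite /= ?ler01 ?lexx.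
rewrite (_ : _ - _ = e * (smon q l - smon q' l) +
   (q x * (dmon s q l - dmon s q' l) + (q x - q' x) * dmon s q' l)); last by ring.
have b1 : `|e * (smon q l - smon q' l)| <= n * ldist q q'.
  rewrite normrM; have /andP[e0 e1'] := e1; rewrite (ger0_norm e0).
  by apply: le_trans (smon_lip l q01 q'01); rewrite ler_piMl.
have b2 : `|q x * (dmon s q l - dmon s q' l)| <= n ^+ 2 * ldist q q'.
  have /andP[q0 q1] := q01 x.
  by rewrite normrM (ger0_norm q0); apply: le_trans IH; rewrite ler_piMl.
have b3 : `|(q x - q' x) * dmon s q' l| <= ldist q q' * n.
  rewrite normrM ler_pM ?ldist_ge//.
  by rewrite ger0_norm ?dmon_ge0// dmon_le.
rewrite (le_trans (ler_normD _ _))//.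
have := ler_normD (q x * (dmon s q l - dmon s q' l)) ((q x - q' x) * dmon s q' l).
rewrite -natr1 -/n (_ : (n + 1) ^+ 2 * _ = n * ldist q q' +
  (n ^+ 2 * ldist q q' + ldist q q' * n) + ldist q q'); last by ring.
lra.
Qed.

(** Euler's identity for a homogeneous polynomial; it turns theta into a series
with the nonnegative coefficients size l - 1. *)
Lemma euler_mon q l : \sum_s q s * dmon s q l = (size l)%:R * smon q l.
Proof.
elim: l => [|x l IH] /=.
  by rewrite mul0r big1// => s _; rewrite mulr0.
rewrite smon_cons.
under eq_bigr do rewrite mulrDr mulrCA [X in _ + X]mulrCA.
rewrite big_split/= -mulr_sumr IH (bigD1 x)//= eqxx mul1r big1 ?addr0.
  by rewrite -natr1; ring.
by move=> s sx; rewrite eq_sym (negbTE sx) mul0r.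
Qed.

(** The remainder is quadratic in h with a constant of order n ^ 2 rho ^ n, which
is summable against the coefficients of xi when rho is small enough. *)
Lemma taylor_mon s q l (rho h : R) : 1 <= rho ->
  (forall s, `|q s| <= rho) -> `|q s + h| <= rho ->
  `|smon [eta q with s |-> q s + h] l - smon q l - h * dmon s q l|
    <= (size l)%:R ^+ 2 * rho ^+ size l * h ^+ 2.
Proof.
move=> rho1 qrho qhrho.
have r0 : 0 <= rho by apply: le_trans rho1.
elim: l => [|x l IH].
  by rewrite /smon !big_nil /= mulr0 subrr subr0 normr0 expr0n /= !mul0r.
have re : 0 <= rho ^+ size l by rewrite exprn_ge0.
have h2 : 0 <= h ^+ 2 by rewrite sqr_ge0.
have nn : 0 <= ((size l)%:R : R) by [].
have dn := dmon_norm s l rho1 qrho.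
rewrite !smon_cons /= (exprS rho) -natr1.
set m' := smon _ l in IH *; set m := smon q l in IH *; set d := dmon s q l in IH dn *.
set n : R := (size l)%:R in IH dn nn *; set r := rho ^+ size l in IH dn re *.
have IH2 : rho * (n ^+ 2 * r * h ^+ 2) + n * r * h ^+ 2 <= (n + 1) ^+ 2 * (rho * r) * h ^+ 2.
  rewrite mulrA -mulrDl ler_wpM2r//.
  have : n * r <= n * r * rho by rewrite ler_peMr// mulr_ge0.
  have : 0 <= n * r * rho by rewrite !mulr_ge0.
  have : 0 <= r * rho by rewrite !mulr_ge0.
  rewrite (_ : (n + 1) ^+ 2 * (rho * r) =
    rho * (n ^+ 2 * r) + 2 * (n * r * rho) + r * rho); last by ring.
  by lra.

apply: le_trans IH2; case: eqVneq => [->|xs] /=.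
  rewrite (_ : _ - _ - _ = (q s + h) * (m' - m - h * d) + d * h ^+ 2); last by ring.
  rewrite (le_trans (ler_normD _ _))// lerD// normrM; first by rewrite ler_pM.
  by rewrite (ger0_norm h2) ler_wpM2r.
rewrite (_ : _ - _ - _ = q x * (m' - m - h * d)); last by ring.
rewrite normrM -[leLHS]addr0; apply: lerD; first by rewrite ler_pM.
by apply: mulr_ge0 => //; exact: mulr_ge0.
Qed.

End monomials.

(** * The covariance function and its derivatives *)

Section covariance.
Context (R : realType) (S : finType).
Variables (lam : S -> R) (beta : nat -> R) (Delta2 : forall p : nat, p.-tuple S -> R).
Arguments Delta2 {p}.
Implicit Types (q : S -> R) (l : seq S).

Definition coef p (t : p.-tuple S) : R := beta p ^+ 2 * (Delta2 t * mon lam t).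

Definition wsum (m : seq S -> R) (p : nat) : R := \sum_(t : p.-tuple S) coef t * m t.

Lemma wsumB m1 m2 p : wsum (fun l => m1 l - m2 l) p = wsum m1 p - wsum m2 p.
Proof. by rewrite /wsum -sumrB; apply: eq_bigr => t _; rewrite mulrBr. Qed.

Lemma wsumZ (c : R) m p : wsum (fun l => c * m l) p = c * wsum m p.
Proof. by rewrite /wsum mulr_sumr; apply: eq_bigr => t _; rewrite mulrCA. Qed.

Lemma xi_tsum q : xi lam beta (@Delta2) q = tsum (wsum (smon q)).
Proof.
congr (limn _); apply/funext => N; apply: eq_bigr => p _.
rewrite /wsum mulr_sumr; apply: eq_bigr => t _.
by rewrite /coef -monE !mulrA.
Qed.

Hypothesis lam_ge0 : forall s, 0 <= lam s.
Hypothesis Delta2_ge0 : forall (p : nat) (t : p.-tuple S), (1 <= p)%N -> 0 <= Delta2 t.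

Lemma coef_ge0 p (t : p.-tuple S) : (0 < p)%N -> 0 <= coef t.
Proof.
move=> p0; apply: mulr_ge0; first exact: sqr_ge0.
by apply: mulr_ge0; [exact: Delta2_ge0|apply: prodr_ge0].
Qed.

Section radius.
Variables (rho B : R).
Hypothesis rho1 : 1 < rho.
Let a p : R := p%:R ^+ 2 * rho ^+ p * wsum (fun=> 1) p.
Hypothesis aB : forall N, \sum_(1 <= p < N) a p <= B.

Let a_ge0 p : (0 < p)%N -> 0 <= a p.
Proof.
move=> p0; rewrite /a mulr_ge0 ?mulr_ge0 ?exprn_ge0// ?(le_trans ler01 (ltW rho1))//.
by apply: sumr_ge0 => t _; rewrite mulr1 coef_ge0.
Qed.

Let B_ge0 : 0 <= B.
Proof. by apply: le_trans (aB 0); rewrite big_geq. Qed.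

(** The majorant a is the series of the coefficients weighted by
p ^ 2 * rho ^ p: the factor p ^ 2 pays for two derivatives, and rho ^ p, with
rho > 1, for leaving the cube by a small step. *)
Lemma wsum_dominated K m : (forall l, (0 < size l)%N ->
    `|m l| <= K * ((size l)%:R ^+ 2 * rho ^+ size l)) -> dominated a K (wsum m).
Proof.
move=> mK p p0; rewrite /wsum (le_trans (ler_norm_sum _ _ _))//.
rewrite /a /wsum !mulr_sumr; apply: ler_sum => t _.
rewrite normrM ger0_norm ?coef_ge0// mulr1.
have := mK t; rewrite size_tuple => /(_ p0) mt.
by rewrite mulrA mulrC ler_wpM2r ?coef_ge0.
Qed.

Let le_size2 (n : nat) : (0 < n)%N -> n%:R <= n%:R ^+ 2 * rho ^+ n.
Proof.
move=> n0; have n1 : 1 <= n%:R :> R by rewrite ler1n.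
have e1 : 1 <= rho ^+ n by rewrite exprn_ege1// ltW.
by rewrite -[leLHS]mulr1 ler_pM// expr2 ler_peMr.
Qed.

Let sqr_size2 (n : nat) : n%:R ^+ 2 <= n%:R ^+ 2 * rho ^+ n.
Proof. by rewrite ler_peMr// exprn_ege1// ltW. Qed.

Lemma smon_dominated q : (forall s, `|q s| <= rho) -> dominated a 1 (wsum (smon q)).
Proof.
move=> qr; apply: wsum_dominated => l l0; rewrite mul1r.
apply: le_trans (smon_norm l (ltW rho1) qr) _.
have n1 : 1 <= (size l)%:R :> R by rewrite ler1n.
by rewrite ler_peMl ?exprn_ege1// exprn_ge0// (le_trans ler01 (ltW rho1)).
Qed.

Let cube_norm q : cube q -> forall s, `|q s| <= 1.
Proof. by move=> q01 s; have /andP[q0 q1] := q01 s; rewrite ger0_norm. Qed.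

Let cube_rho q : cube q -> forall s, `|q s| <= rho.
Proof. by move=> /cube_norm q1 s; apply: le_trans (q1 s) (ltW rho1). Qed.

Lemma dmon_dominated s q : cube q -> dominated a 1 (wsum (dmon s q)).
Proof.
move=> q01; apply: wsum_dominated => l l0; rewrite mul1r.
by rewrite ger0_norm ?dmon_ge0// (le_trans (dmon_le s l q01))// le_size2.
Qed.

(** Summing the Taylor estimates of the monomials gives a quadratic remainder for
xi itself.  Steps of both signs are allowed, also from the faces of the cube,
since the series converges for coordinates of modulus at most rho. *)
Lemma partial_xi s q : cube q ->
  partial (xi lam beta (@Delta2)) s q = tsum (wsum (dmon s q)).
Proof.
move=> q01; set D := tsum _.
pose f (t : R) : R := xi lam beta (@Delta2) [eta q with s |-> t].
rewrite -[partial _ _ _]/(derive1 f (q s)) /derive1.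
have f0 : f (q s) = xi lam beta (@Delta2) q.
  have e : [eta q with s |-> q s] = q :> (S -> R).
      by apply/funext => s' /=; case: eqVneq => [->|].
    by rewrite /f e.
have key h : `|h| <= rho - 1 -> `|f (q s + h) - f (q s) - h * D| <= B * h ^+ 2.
  move=> hr; rewrite f0 /f !xi_tsum.
  have qh : `|q s + h| <= rho.
    by have := ler_normD (q s) h; have := cube_norm q01 s; lra.
  have d1 : dominated a 1 (wsum (smon [eta q with s |-> q s + h])).
    by apply: smon_dominated => s' /=; case: eqVneq => // _; exact: cube_rho.
  have d2 := smon_dominated (cube_rho q01).
  have d3 := dmon_dominated s q01.
  rewrite -(tsumB a_ge0 aB d1 d2) -(tsumZ a_ge0 aB h d3).
  rewrite -(tsumB a_ge0 aB (dominatedB d1 d2) (dominatedZ h d3)).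
  rewrite [leRHS]mulrC; apply: (tsum_bound a_ge0 aB); first exact: sqr_ge0.
  rewrite (_ : (fun p => _) = wsum (fun l => smon [eta q with s |-> q s + h] l
      - smon q l - h * dmon s q l)); last first.
    by apply/funext => p; rewrite !wsumB wsumZ.
  apply: wsum_dominated => l l0; rewrite [leRHS]mulrC.
  exact: taylor_mon (ltW rho1) (cube_rho q01) qh.
apply/cvg_lim => //; apply/cvgrPdist_le => /= e e0.
have [r0 B1] : 0 < rho - 1 /\ 0 < B + 1 by rewrite subr_gt0 rho1 ltr_wpDl ?B_ge0.
near=> h.
have h0 : h != 0 by near: h; exact: nbhs_dnbhs_neq.
have hr : `|h| <= rho - 1 by near: h; exact: dnbhs0_le.
have he : `|h| <= e / (B + 1) by near: h; apply: dnbhs0_le; rewrite divr_gt0.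
have := key h hr; rewrite (addrC h).
set df := f (q s + h) - f (q s) => kh.
have hn : 0 < `|h| by rewrite normr_gt0.
rewrite distrC -(ler_pM2l hn) -normrM mulrBr.
rewrite -[h^-1 *: df]/(h^-1 * df) mulrA divff// mul1r (le_trans kh)//.
rewrite -real_normK ?num_real// expr2 mulrCA ler_wpM2l//.
move: he; rewrite ler_pdivlMr// => he; apply: le_trans he.
by rewrite mulrC ler_wpM2l// lerDl.
Unshelve. all: by end_near. Qed.

(** The three properties of xi_s and theta on the cube that the rest of the proof
uses. *)
Definition tame K (f : (S -> R) -> R) := forall q q', cube q -> cube q' ->
  [/\ 0 <= f q <= K, (forall s, q s <= q' s) -> f q <= f q' &
      `|f q - f q'| <= K * ldist q q'].

(** Each property passes from the terms to the sum of a dominated series with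
nonnegative coefficients. *)
Lemma tame_tsum (m : (S -> R) -> seq S -> R) :
  (forall q, cube q -> forall l, (0 < size l)%N -> 0 <= m q l <= (size l)%:R ^+ 2) ->
  (forall q q', cube q -> cube q' -> (forall s, q s <= q' s) ->
     forall l, (0 < size l)%N -> m q l <= m q' l) ->
  (forall q q', cube q -> cube q' -> forall l, (0 < size l)%N ->
     `|m q l - m q' l| <= (size l)%:R ^+ 2 * ldist q q') ->
  tame B (fun q => tsum (wsum (m q))).
Proof.
move=> mb mle mlip q q' q01 q'01.
have md r : cube r -> dominated a 1 (wsum (m r)).
  move=> r01; apply: wsum_dominated => l l0; rewrite mul1r.
  have /andP[m0 m1] := mb r r01 l l0.
  by rewrite ger0_norm// (le_trans m1) ?sqr_size2.
split.
- apply/andP; split; last first.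
    apply: le_trans (ler_norm _) _; rewrite -[leRHS]mul1r.
    by apply: (tsum_bound a_ge0 aB); [|exact: md].
  rewrite (_ : 0 = tsum (fun=> 0 : R)); last first.
    rewrite /tsum (_ : (fun N => _) = fun=> 0) ?lim_cst//.
    by apply/funext => N; rewrite big1.
  apply: (le_tsum a_ge0 aB (K1 := 0) _ (md q q01)).
    by move=> p p0; rewrite normr0 mul0r.
  move=> p p0; rewrite /wsum sumr_ge0// => t _; rewrite mulr_ge0 ?coef_ge0//.
  by have /andP[] := mb q q01 t (etrans (congr1 (leq 1) (size_tuple t)) p0).
- move=> qq'; apply: (le_tsum a_ge0 aB (md q q01) (md q' q'01)) => p p0.
  apply: ler_sum => t _; rewrite ler_wpM2l ?coef_ge0//.
  by apply: mle => //; rewrite size_tuple.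
- rewrite -(tsumB a_ge0 aB (md q q01) (md q' q'01)) mulrC.
  apply: (tsum_bound a_ge0 aB); first exact: ldist_ge0.
  rewrite (_ : (fun p => _) = wsum (fun l => m q l - m q' l)); last first.
    by apply/funext => p; rewrite wsumB.
  apply: wsum_dominated => l l0; apply: le_trans (mlip q q' q01 q'01 l l0) _.
  by rewrite mulrC ler_wpM2l ?ldist_ge0.
Qed.

Lemma tame_partial s : tame B (partial (xi lam beta (@Delta2)) s).
Proof.
move=> q q' q01 q'01; rewrite !partial_xi//.
apply: (@tame_tsum (dmon s)) => //.
- move=> r r01 l l0; rewrite dmon_ge0//= (le_trans (dmon_le s l r01))//.
  by rewrite expr2 ler_peMr// ler1n.
- by move=> r r' r01 r'01 rr' l l0; exact: le_dmon.
- by move=> r r' r01 r'01 l l0; exact: dmon_lip.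
Qed.

Lemma theta_tsum q : cube q ->
  theta lam beta (@Delta2) q = tsum (wsum (fun l => ((size l)%:R - 1) * smon q l)).
Proof.
move=> q01; rewrite /theta xi_tsum.
under eq_bigr do rewrite partial_xi//.
have d s : dominated a 1 (fun p => q s * wsum (dmon s q) p).
  move=> p p0; have := dmon_dominated s q01 p0.
  apply: le_trans; rewrite normrM ler_piMl//; exact: cube_norm.
rewrite (eq_bigr (fun s => tsum (fun p => q s * wsum (dmon s q) p))); last first.
  by move=> s _; rewrite (tsumZ a_ge0 aB _ (dmon_dominated s q01)).
have [K dK] := dominated_sum d.
rewrite -(tsum_sum a_ge0 aB d) -(tsumB a_ge0 aB dK (smon_dominated (cube_rho q01))).
congr tsum; apply/funext => p.
rewrite /wsum; under eq_bigr do rewrite mulr_sumr.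
rewrite exchange_big -sumrB; apply: eq_bigr => t _ /=.
rewrite mulrBl mul1r -euler_mon mulrBr mulr_sumr; congr (_ - _).
by apply: eq_bigr => s _; rewrite mulrCA.
Qed.

Lemma tame_theta : tame B (theta lam beta (@Delta2)).
Proof.
have sz (l : seq S) : (0 < size l)%N -> 0 <= (size l)%:R - 1 :> R.
  by move=> l0; rewrite subr_ge0 ler1n.
move=> q q' q01 q'01; rewrite !theta_tsum//.
apply: (@tame_tsum (fun q l => ((size l)%:R - 1) * smon q l)) => //.
- move=> r r01 l l0; have /andP[m0 m1] := smon01 l r01; have s0 := sz l l0.
  rewrite mulr_ge0//=; apply: (@le_trans _ _ ((size l)%:R - 1)); first by rewrite ler_piMr.
  by rewrite expr2 (@le_trans _ _ (size l)%:R) ?gerBl// ler_peMr// ler1n.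
- by move=> r r' r01 r'01 rr' l l0; rewrite ler_wpM2l ?sz// le_smon.
- move=> r r' r01 r'01 l l0; rewrite -mulrBr normrM ger0_norm ?sz//.
  apply: (@le_trans _ _ ((size l)%:R * ((size l)%:R * ldist r r'))).
    by rewrite ler_pM ?sz ?smon_lip// gerBl.
  by rewrite mulrA expr2.
Qed.

End radius.

Lemma ler_geom (eta : R) (p : nat) : 0 <= eta -> p%:R * eta <= (1 + eta) ^+ p.
Proof.
move=> e0; suff : 1 + p%:R * eta <= (1 + eta) ^+ p by lra.
elim: p => [|p IH]; first by rewrite mul0r addr0 expr0.
rewrite exprS -natr1; have p0 : 0 <= (p%:R : R) by [].
apply: (@le_trans _ _ ((1 + eta) * (1 + p%:R * eta))); last by rewrite ler_wpM2l//; lra.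
have : 0 <= p%:R * eta ^+ 2 by rewrite mulr_ge0 ?sqr_ge0.
by rewrite (_ : (1 + eta) * _ = 1 + (p%:R + 1) * eta + p%:R * eta ^+ 2); [lra|ring].
Qed.

(** With (1 + eta) ^ 4 <= 1 + eps and rho = (1 + eta) ^ 2, the weight
p ^ 2 * rho ^ p is at most (1 + eps) ^ p / eta ^ 2, as p * eta <= (1 + eta) ^ p. *)
Lemma exists_radius : (exists2 eps : R, 0 < eps &
       (\sum_(1 <= p <oo)
          (beta p ^+ 2 * (1 + eps) ^+ p *
             \sum_(t : p.-tuple S) Delta2 t * mon lam t)%:E < +oo)%E) ->
  exists rho B : R, 1 < rho /\ forall N,
    \sum_(1 <= p < N) (p%:R ^+ 2 * rho ^+ p * wsum (fun=> 1) p) <= B.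
Proof.
move=> [eps eps0 ufin].
pose u p : \bar R := (beta p ^+ 2 * (1 + eps) ^+ p *
  \sum_(t : p.-tuple S) Delta2 t * mon lam t)%:E.
have {}ufin : (\sum_(1 <= p <oo) u p < +oo)%E by exact: ufin.
have wE p : wsum (fun=> 1) p = beta p ^+ 2 * \sum_(t : p.-tuple S) Delta2 t * mon lam t.
  by rewrite /wsum mulr_sumr; apply: eq_bigr => t _; rewrite mulr1.
have w0 p : (0 < p)%N -> 0 <= wsum (fun=> 1) p.
  by move=> p0; apply: sumr_ge0 => t _; rewrite mulr1 coef_ge0.
have [eta [eta0 eta4]] : exists eta : R, 0 < eta /\ (1 + eta) ^+ 4 <= 1 + eps.
  (* (1 + y) ^ 4 <= 1 + 15 y for y in [0, 1]. *)
  exists (Num.min eps 1 / 15); split; first by rewrite divr_gt0// lt_min eps0 ltr01.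
  have : 0 < Num.min eps 1 by rewrite lt_min eps0 ltr01.
  have : Num.min eps 1 <= eps by rewrite ge_min lexx.
  have : Num.min eps 1 <= 1 by rewrite ge_min lexx orbT.
  set x := Num.min eps 1 => x1 xe x0.
  have : 15 * (x / 15) = x by rewrite mulrC divfK.
  set y := x / 15 => yx.
  have y0 : 0 <= y by lra.
  have y1 : y <= 1 by lra.
  have y2 : y ^+ 2 <= y by rewrite expr2 ler_piMr.
  have y3 : y ^+ 3 <= y by rewrite exprS ler_piMr// (le_trans y2).
  have y4 : y ^+ 4 <= y by rewrite exprS ler_piMr// (le_trans y3).
  rewrite (_ : (1 + y) ^+ 4 = 1 + 4 * y + 6 * y ^+ 2 + 4 * y ^+ 3 + y ^+ 4); last by ring.
  lra.
have [C uC] : exists C : R, forall N,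
    \sum_(1 <= p < N) (1 + eps) ^+ p * wsum (fun=> 1) p <= C.
  have u0 n : (1 <= n)%N -> (0 <= u n)%E.
    move=> n1; rewrite /u /= lee_fin -mulrA mulrCA -wE mulr_ge0 ?w0//.
    by rewrite exprn_ge0//; lra.
  exists (fine (\sum_(1 <= p <oo) u p)%E) => N.
  have := @nneseries_lim_ge R u xpredT 1 N (fun n n1 _ => u0 n n1).
  rewrite -lee_fin fineK; last first.
    by rewrite ge0_fin_numE//; apply: nneseries_ge0 => n n1 _; exact: u0.
  apply: le_trans; rewrite -sumEFin le_eqVlt; apply/orP; left; apply/eqP.
  by apply: eq_bigr => p _; rewrite /u -[in RHS]mulrA [in RHS]mulrCA -wE.
exists ((1 + eta) ^+ 2), (eta ^- 2 * C); split.
  by rewrite exprn_egt1//; lra.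
move=> N; apply: (@le_trans _ _ (eta ^- 2 *
  \sum_(1 <= p < N) (1 + eps) ^+ p * wsum (fun=> 1) p)); last first.
  by rewrite ler_wpM2l// invr_ge0 sqr_ge0.
rewrite mulr_sumr !big_nat; apply: ler_sum => p /andP[p0 _].
rewrite mulrA ler_wpM2r ?w0// [leRHS]mulrC ler_pdivlMr ?exprn_gt0//.
have pe : 0 <= p%:R * eta by rewrite mulr_ge0// ltW.
have e1 : 0 <= 1 + eta by lra.
have := ler_geom p (ltW eta0) => pep.
apply: (@le_trans _ _ (((1 + eta) ^+ p) ^+ 2 * ((1 + eta) ^+ 2) ^+ p)).
  rewrite mulrAC -exprMn ler_wpM2r ?exprn_ge0//.
  by rewrite ler_pXn2r// nnegrE// exprn_ge0.
rewrite -!exprM mulnC -exprD addnn -mul2n mulnA exprM.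
by rewrite lerXn2r// nnegrE ?exprn_ge0//; lra.
Qed.

End covariance.

(** * Limits along an ultrafilter *)

Section ultralimits.
Context (R : realType) (U : set_system nat) (UU : UltraFilter U).

Definition ulim (u : nat -> R) : R := lim (u n @[n --> U]).

(** A cluster point exists by compactness of [a, b]; an ultrafilter that clusters
at a point converges to it, as it contains each set or its complement. *)
Lemma cvg_ulim (u : nat -> R) (a b : R) : (forall n, a <= u n <= b) ->
  u n @[n --> U] --> ulim u.
Proof.
move=> uab; pose F := u n @[n --> U].
have FP : ProperFilter F by apply: fmap_proper_filter.
have Fab : F `[a, b]%classic.
  by apply: nearW => n; rewrite /= in_itv/= uab.
have [p [_ clp]] := segment_compact FP Fab.
suff Up : u n @[n --> U] --> p by rewrite /ulim (cvg_lim _ Up).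
move=> V Vp; have [//|nV] := in_ultra_setVsetC (u @^-1` V) UU.
by have [x []] := clp (~` V) V nV Vp.
Qed.

End ultralimits.

(** * The logarithmic barrier *)

Section log_barrier.
Context (R : realType).
Implicit Types (L M : R) (g h X : R -> R).

Lemma riemann_subl M k g h (a b : R) n :
  riemann k (fun x => M - g x) h a b n = M * (h b - h a) - riemann k g h a b n.
Proof.
rewrite /riemann; under eq_bigr do rewrite mulrBl.
by rewrite sumrB -mulr_sumr telescope_sumr// mesh0 meshn.
Qed.

Lemma ln_le_subr1 (x : R) : 0 < x -> ln x <= x - 1.
Proof.
move=> x0; have := @le_ln1Dx R (x - 1).
by rewrite (_ : 1 + (x - 1) = x); [apply; lra|ring].
Qed.

Lemma ln_diff_le (x y : R) : 0 < x -> 0 < y -> ln y - ln x <= x^-1 * (y - x).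
Proof.
move=> x0 y0; rewrite -ln_div ?posrE// (le_trans (ln_le_subr1 _))// ?divr_gt0//.
by rewrite mulrBr mulVf ?gt_eqF// mulrC.
Qed.

Section barrier.
Variables (L : R) (h X : R -> R) (c : R).
Hypotheses (hL : mono_lip01 L h) (Xnd : nd01 X) (X01 : range01 1 X).
Let d q := stieltjes X h q 1.

(** As 0 <= X <= 1, the integral of X h' over [x, y] is at most that of h'. *)
Lemma tail_incr x y : 0 <= x -> x <= y -> y <= 1 ->
  0 <= d x - d y <= h y - h x.
Proof.
move=> x0 xy y1; rewrite /d (stieltjes_cat hL (nd01_bounded_meas Xnd) x0 xy y1 (lexx _)) addrK.
apply/andP; split.
  apply: (stieltjes_ge0 hL (nd01_bounded_meas Xnd) x0 y1) => z xz.
  have z01 : 0 <= z <= 1 by lra.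
  by have /andP[] := X01 z01.
have -> : h y - h x = stieltjes (fun=> 1) h x y by rewrite (stieltjes_cst _ hL)// mul1r.
apply: (le_stieltjes hL (nd01_bounded_meas Xnd) (bounded_meas01_cst 1) x0 y1) => z xz.
have z01 : 0 <= z <= 1 by lra.
by have /andP[] := X01 z01.
Qed.

Lemma tail1 : d 1 = 0.
Proof.
rewrite /d.
have := stieltjes_cat hL (nd01_bounded_meas Xnd) ler01 (lexx 1) (lexx 1) (lexx 1).
lra.
Qed.

Lemma tail_ge0 x : 0 <= x <= 1 -> 0 <= d x.
Proof.
by move=> /andP[x0 x1]; have := tail_incr x0 x1 (lexx 1); rewrite tail1; lra.
Qed.

Lemma gap_lip : mono_lip01 L (fun q => c - d q).
Proof.
move=> x y x0 xy y1; have := tail_incr x0 xy y1; have := hL x0 xy y1; lra.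
Qed.

Hypothesis c0 : 0 < c - d 0.
Let e q := c - d q.

Lemma gap_ge x : 0 <= x <= 1 -> c - d 0 <= c - d x.
Proof. by move=> /andP[x0 x1]; have := tail_incr (lexx 0) x0 x1; lra. Qed.

Lemma gap_gt0 x : 0 <= x <= 1 -> 0 < c - d x.
Proof. by move=> /gap_ge; exact: lt_le_trans. Qed.

Lemma gapV_ni : nd01 (fun q => - (c - d q)^-1).
Proof.
move=> x y x0 xy y1; rewrite lerN2 lef_pV2 ?posrE ?gap_gt0; try lra.
by have := tail_incr x0 xy y1; lra.
Qed.

Lemma gapV_range01 : range01 (c - d 0)^-1 (fun q => (c - d q)^-1).
Proof.
move=> x x01; rewrite invr_ge0 (ltW (gap_gt0 x01))/=.
by rewrite lef_pV2; [exact: gap_ge|exact: gap_gt0|exact: c0].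
Qed.

(** On each cell of a partition, ln e(y) - ln e(x) <= (e(y) - e(x)) / e(x), where
e = c - d.  Moving the denominator to the right end costs O(1/n) in total, and
the increments of e are at most those of h since X <= 1. *)
Lemma log_barrier : ln c - ln (c - d 0) <= stieltjes (fun q => (c - d q)^-1) h 0 1.
Proof.
set M := (c - d 0)^-1; set g := (fun q => (c - d q)^-1).
have M0 : 0 <= M by rewrite invr_ge0 ltW.
have L0 := mono_lip01_ge0 hL.
pose g' x := M - g x.
have g'nd : nd01 g' by move=> x y x0 xy y1; rewrite lerD2l; exact: gapV_ni.
have g'M : range01 M g'.
  by move=> x x01; have := gapV_range01 x01; rewrite -/M -/(g x) /g'; lra.
have gbm : bounded_meas01 g.
  by have := bounded_meas01N (nd01_bounded_meas gapV_ni); under eq_fun do rewrite opprK.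
have key n : ln c - ln (c - d 0) <= stieltjes g h 0 1 + L * M / n.+1%:R.
  have h1 := stieltjes_le_riemann n hL g'nd (lexx 0) ler01 (lexx 1).
  have h2 := riemann_gap n gap_lip g'nd g'M (lexx 0) ler01 (lexx 1).
  rewrite (stieltjes_subl _ hL gbm) ?lexx ?ler01// !riemann_subl in h1 h2.
  have mesh01 i : (i <= n.+1)%N -> 0 <= @mesh R 0 1 n i <= 1.
    by move=> i_n; exact: mesh_itv ler01 i_n.
  have h3 : riemann 1 g e 0 1 n <= riemann 1 g h 0 1 n.
    apply: ler_sum_nat => i /andP[_ i_n]; rewrite add1n.
    have /andP[p0 _] := mesh01 _ (ltnW i_n); have p1 := mesh01 _ i_n.
    rewrite ler_wpM2l//; first by have /andP[] := gapV_range01 p1.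
    have /andP[_ p1'] := p1.
    by have := tail_incr p0 (le_mesh n i ler01) p1'; rewrite /e; lra.
  have h4 : ln c - ln (c - d 0) <= riemann 0 g e 0 1 n.
    have -> : ln c - ln (c - d 0) =
        \sum_(0 <= i < n.+1) (ln (e (mesh 0 1 n i.+1)) - ln (e (mesh 0 1 n i))).
      by rewrite (telescope_sumr (fun i => ln (e (mesh 0 1 n i))))// mesh0 meshn /e tail1 subr0.
    apply: ler_sum_nat => i /andP[_ i_n]; rewrite add0n.
    by apply: ln_diff_le; rewrite gap_gt0// mesh01// ltnW.
  have aux (x y z t : R) : x - y <= x - z + t -> z <= y + t by lra.
  apply: (le_trans h4); apply: (le_trans (aux _ _ _ _ h2)).
  rewrite lerD2r; apply: (le_trans h3).
  by rewrite lerD2l lerN2 in h1.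
apply/ler_addgt0Pr => eps eps0.
pose t := L * M / eps.
apply: le_trans (key (Num.bound t)) _; rewrite lerD2l ler_pdivrMr// [leRHS]mulrC -ler_pdivrMr//.
have t0 : 0 <= t by rewrite divr_ge0 ?mulr_ge0// ltW.
by apply: ltW; apply: lt_trans (archi_boundP t0) _; rewrite ltr_nat.
Qed.

End barrier.
End log_barrier.

(** * Admissible maps *)

Section admissible.
Context (R : realType) (S : finType) (lam : S -> R).
Hypothesis lam_gt0 : forall s, 0 < lam s.

(** For an admissible map, the l1 distance between Phi x and Phi y is at most
path_slope * |x - y|. *)
Definition path_slope : R := \sum_s (lam s)^-1.

Lemma admissible_cube Phi x : admissible_map lam Phi -> 0 <= x <= 1 -> cube (Phi x).
Proof. by move=> [Phi01 _ _ _] x01 s; apply: Phi01; rewrite in_itv. Qed.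

(** All the increments of the coordinates are nonnegative and their weighted sum is
y - x, so each of them is at most (y - x) / lam s. *)
Lemma path_lip (Phi : R -> S -> R) (x y : R) s :
  (forall s x y, 0 <= x -> x <= y -> y <= 1 -> Phi x s <= Phi y s) ->
  (forall x, 0 <= x <= 1 -> \sum_s lam s * Phi x s = x) ->
  0 <= x -> x <= y -> y <= 1 ->
  0 <= Phi y s - Phi x s <= (lam s)^-1 * (y - x).
Proof.
move=> Pnd Psum x0 xy y1; rewrite subr_ge0 Pnd//= mulrC ler_pdivlMr//.
have <- : \sum_s lam s * Phi y s - \sum_s lam s * Phi x s = y - x.
  by rewrite !Psum// ?x0 ?(le_trans x0 xy) ?y1 ?(le_trans xy y1).
rewrite -sumrB (bigD1 s)//= -mulrBr mulrC lerDl sumr_ge0// => i _.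
by rewrite -mulrBr mulr_ge0 ?(ltW (lam_gt0 i))// subr_ge0 Pnd.
Qed.

Lemma admissible_mono (Phi : R -> S -> R) : admissible_map lam Phi ->
  (forall s x y, 0 <= x -> x <= y -> y <= 1 -> Phi x s <= Phi y s) /\
  (forall x, 0 <= x <= 1 -> \sum_s lam s * Phi x s = x).
Proof.
move=> [_ _ Pnd Psum]; split=> [s x y x0 xy y1|x x01].
  by apply: Pnd => //; rewrite in_itv/= ?x0 ?y1 ?(le_trans xy)// (le_trans x0).
by apply: Psum; rewrite in_itv.
Qed.

Lemma path_mono_lip01 K (f : (S -> R) -> R) Phi : tame K f -> admissible_map lam Phi ->
  mono_lip01 (K * path_slope) (f \o Phi).
Proof.
move=> fK aPhi x y x0 xy y1; have [Pnd Psum] := admissible_mono aPhi.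
have Plip s := path_lip s Pnd Psum x0 xy y1.
have x01 : 0 <= x <= 1 by rewrite x0 (le_trans xy).
have y01 : 0 <= y <= 1 by rewrite y1 (le_trans x0).
have cx := admissible_cube aPhi x01.
have cy := admissible_cube aPhi y01.
have [f0 fle _] := fK _ _ cx cy.
have [_ _ flip] := fK _ _ cy cx.
have K0 : 0 <= K by case/andP: f0; exact: le_trans.
have fxy : 0 <= (f \o Phi) y - (f \o Phi) x.
  by rewrite subr_ge0; apply: fle => s; exact: Pnd.
rewrite fxy/= -(ger0_norm fxy); apply: (le_trans flip); rewrite -mulrA ler_wpM2l//.
rewrite /ldist /path_slope mulr_suml; apply: ler_sum => s _.
by have /andP[p0 p1] := Plip s; rewrite ger0_norm.
Qed.

(** Pointwise limits suffice: monotonicity and the sum condition pass to the limit,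
and they imply that the limit is Lipschitz. *)
Lemma admissible_limit (F : set_system nat) (FF : ProperFilter F)
    (Phi_ : nat -> R -> S -> R) (Phi : R -> S -> R) :
  (forall n, admissible_map lam (Phi_ n)) ->
  (forall x s, 0 <= x <= 1 -> Phi_ n x s @[n --> F] --> Phi x s) ->
  admissible_map lam Phi.
Proof.
move=> adm Pcv.
have Pnd s x y : 0 <= x -> x <= y -> y <= 1 -> Phi x s <= Phi y s.
  move=> x0 xy y1; apply: (ler_cvg_to (Pcv x s _) (Pcv y s _)).
  - by rewrite x0 (le_trans xy).
  - by rewrite y1 (le_trans x0).
  - by apply: nearW => n; have [H _] := admissible_mono (adm n); exact: H.
have Psum x : 0 <= x <= 1 -> \sum_s lam s * Phi x s = x.
  move=> x01; have c1 : \sum_s lam s * Phi_ n x s @[n --> F] --> \sum_s lam s * Phi x s.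
    apply: cvg_big => [|s _]; first exact: add_continuous.
    by apply: cvgMr; exact: Pcv.
  apply: (cvg_unique _ c1) => //; apply: cvg_near_cst; apply: nearW => n.
  by have [_ H] := admissible_mono (adm n); exact: H.
split.
- move=> x s; rewrite in_itv/= => x01; apply/andP; split.
    apply: (cvgr_to_ge (Pcv x s x01)); apply: nearW => n.
    by have /andP[] := admissible_cube (adm n) x01 s.
  apply: (cvgr_to_le (Pcv x s x01)); apply: nearW => n.
  by have /andP[] := admissible_cube (adm n) x01 s.
- move=> s; have Plip : mono_lip01 (lam s)^-1 (fun x => Phi x s).
    by move=> x y; exact: path_lip.
  apply: (@subspace_eq_continuous _ _ _ ((fun x => Phi x s) \o @clamp R)).
    by move=> x; rewrite inE/= in_itv/= => x01; rewrite clampE.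
  exact: continuous_subspaceT (mono_lip_continuous (mono_lip01_clamp Plip)).
- by move=> s x y; rewrite !in_itv/= => /andP[x0 _] /andP[_ y1] xy; exact: Pnd.
- by move=> x; rewrite in_itv/=; exact: Psum.
Qed.

Lemma admissible_id : \sum_s lam s = 1 -> admissible_map lam (fun x _ => x).
Proof.
move=> lam1; split.
- by move=> x s; rewrite in_itv.
- by move=> s; apply: continuous_subspaceT => x; exact: cvg_id.
- by move=> s x y.
- by move=> x _; rewrite -mulr_suml lam1 mul1r.
Qed.

Lemma tame_cvg K (f : (S -> R) -> R) (F : set_system nat) (FF : ProperFilter F)
    (q_ : nat -> S -> R) (q : S -> R) : tame K f ->
  (forall n, cube (q_ n)) -> (forall s, q_ n s @[n --> F] --> q s) ->
  f (q_ n) @[n --> F] --> f q.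
Proof.
move=> fK q_01 qcv.
have q01 : cube q.
  move=> s; apply/andP; split.
    by apply: (cvgr_to_ge (qcv s)); apply: nearW => n; have /andP[] := q_01 n s.
  by apply: (cvgr_to_le (qcv s)); apply: nearW => n; have /andP[] := q_01 n s.
have dcv : K * ldist q (q_ n) @[n --> F] --> (0 : R).
  have -> : (0 : R) = K * \sum_(s : S) 0 by rewrite big1 ?mulr0.
  apply: cvgMr; apply: cvg_big => [|s _]; first exact: add_continuous.
  rewrite -(normr0 R) -(subrr (q s)); apply: cvg_norm.
  by apply: cvgB; [exact: cvg_cst|exact: qcv].
apply/cvgrPdist_le => e e0; move/cvgrPdist_le : dcv => /(_ e e0).
apply: filterS => n; rewrite sub0r normrN.
have [_ _ flip] := fK _ _ q01 (q_01 n).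
by apply: le_trans; apply: le_trans (ler_norm _).
Qed.

End admissible.

(** * Distribution functions on the unit interval *)

Section cdf01.
Context (R : realType) (zeta : probability (measurableTypeR R) R).
Hypothesis zeta1 : zeta `[0, 1]%classic = 1%E.

Definition cdf01 (u : R) : R := fine (zeta `[0, u]%classic).

Lemma cdf01_nd : nd01 cdf01.
Proof.
move=> x y _ xy _; rewrite /cdf01 fine_le ?fin_num_measure//.
by apply: le_measure; rewrite ?inE//; exact: subset_itvl.
Qed.

Lemma cdf01_range01 : range01 1 cdf01.
Proof.
move=> x _; rewrite /cdf01 fine_ge0//=.
by rewrite -[1]/(fine 1%E) fine_le ?fin_num_measure// probability_le1.
Qed.

Lemma cdf01_1 : cdf01 1 = 1.
Proof. by rewrite /cdf01 zeta1. Qed.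

End cdf01.

(** * The contribution of one species *)

Section one_species.
Context (R : realType).
Implicit Types (L z c : R) (X h : R -> R).

(** The bracket of the species s in A, with z, X, h, c in place of xi_s(0), the
distribution function of zeta, xi_s \o Phi and b s. *)
Definition species_term z X h c : R :=
  c - 1 - ln c + z / (c - stieltjes X h 0 1)
  + stieltjes (fun q => (c - stieltjes X h q 1)^-1) h 0 1.

Lemma species_term_ge L z X h c : mono_lip01 L h -> nd01 X -> range01 1 X -> 0 <= z ->
  0 < c - stieltjes X h 0 1 -> c - 1 - ln (c - stieltjes X h 0 1) <= species_term z X h c.
Proof.
move=> hL Xnd X01 z0 e0; have lb := log_barrier hL Xnd X01 e0.
have ze : 0 <= z / (c - stieltjes X h 0 1) by rewrite divr_ge0// ltW.
rewrite /species_term; move: lb ze; clear.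
set x := ln (c - _); set y := stieltjes _ _ _ _; set w := z / _; set v := ln c.
by clearbody x y w v; lra.
Qed.

(** As e <= c, the hypothesis bounds both - ln e and c - 1 - ln c; the latter
grows like c, by ln (c / 2) <= c / 2 - 1. *)
Lemma entropy_bounds c e C : 0 < e -> e <= c -> c - 1 - ln e <= C ->
  expR (- 1 - C) <= e /\ c <= 2 * (C + ln 2).
Proof.
move=> e0 ec H; have c0 : 0 < c by exact: lt_le_trans ec.
split.
  rewrite -[leRHS](lnK (x := e)) ?posrE// ler_expR; lra.
have lec : ln e <= ln c by rewrite ler_ln ?posrE.
have c2 : ln (c / 2) <= c / 2 - 1 by apply: ln_le_subr1; rewrite divr_gt0.
by move: c2; rewrite ln_div ?posrE//; lra.
Qed.

Section limit.
Variables (F : set_system nat) (FF : ProperFilter F) (L delta z : R).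
Variables (X_ h_ : nat -> R -> R) (Xb X h : R -> R) (c_ : nat -> R) (c : R).
Hypotheses (hL_ : forall n, mono_lip01 L (h_ n)) (Xnd_ : forall n, nd01 (X_ n)).
Hypotheses (X01_ : forall n, range01 1 (X_ n)).
Hypotheses (Xcv : forall x : R, 0 <= x <= 1 -> X_ n x @[n --> F] --> Xb x).
Hypotheses (hcv : forall x : R, 0 <= x <= 1 -> h_ n x @[n --> F] --> h x).
Hypotheses (Xnd : nd01 X) (X01 : range01 1 X).
Hypotheses (XbX : forall x : R, 0 <= x <= 1 -> Xb x <= X x).
Hypotheses (XXb : forall x y : R, 0 <= x -> x < y -> y <= 1 -> X x <= Xb y).
Hypotheses (ccv : c_ n @[n --> F] --> c) (delta0 : 0 < delta).
Hypothesis gap_ : forall n, delta <= c_ n - stieltjes (X_ n) (h_ n) 0 1.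

Let hL : mono_lip01 L h. Proof. exact: mono_lip01_cvg hL_ hcv. Qed.

Let dcv x : 0 <= x <= 1 -> stieltjes (X_ n) (h_ n) x 1 @[n --> F] --> stieltjes X h x 1.
Proof. by move=> /andP[x0 x1]; apply: (stieltjes_cvg FF hL_ Xnd_ X01_ Xcv hcv). Qed.

Let ecv x : 0 <= x <= 1 ->
  c_ n - stieltjes (X_ n) (h_ n) x 1 @[n --> F] --> c - stieltjes X h x 1.
Proof. by move=> x01; apply: cvgB ccv _; exact: dcv. Qed.

Lemma gap_limit : delta <= c - stieltjes X h 0 1.
Proof.
have c0 : 0 <= (0 : R) <= 1 by rewrite lexx ler01.
by apply: (cvgr_to_ge (ecv c0)); exact: nearW.
Qed.

Let gap_pos_ n : 0 < c_ n - stieltjes (X_ n) (h_ n) 0 1.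
Proof. exact: lt_le_trans (gap_ n). Qed.

Let gap_pos : 0 < c - stieltjes X h 0 1.
Proof. exact: lt_le_trans gap_limit. Qed.

Lemma level_limit_gt0 : 0 < c.
Proof.
apply: lt_le_trans gap_pos _; rewrite gerBl.
by apply: (tail_ge0 hL Xnd X01); rewrite lexx ler01.
Qed.

(** First the tail integrals converge pointwise, then the gaps c - d, which stay
above delta, and then the nonincreasing integrands 1 / (c - d). *)
Lemma species_term_cvg :
  species_term z (X_ n) (h_ n) (c_ n) @[n --> F] --> species_term z X h c.
Proof.
have o01 : 0 <= (0 : R) <= 1 by rewrite lexx ler01.
rewrite /species_term; apply: cvgD; first apply: cvgD; first apply: cvgB.
- by apply: cvgB ccv _; exact: cvg_cst.
- by apply: (cvg_comp _ _ ccv); exact: continuous_ln level_limit_gt0.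
- apply: cvgMr; apply: cvgV; first by rewrite gt_eqF// gap_pos.
  exact: ecv.
apply: (@stieltjes_cvg_ni _ F FF L delta^-1) => //.
- by move=> n; exact: (gapV_ni (hL_ n) (Xnd_ n) (X01_ n) (gap_pos_ n)).
- move=> n x x01; have /andP[g0 g1] := gapV_range01 (hL_ n) (Xnd_ n) (X01_ n) (gap_pos_ n) x01.
  apply/andP; split; first exact: g0.
  apply: (le_trans g1); rewrite lef_pV2; first exact: gap_.
    exact: gap_pos_.
  exact: delta0.
- move=> x x01; apply: cvgV; last exact: ecv.
  by rewrite gt_eqF// (gap_gt0 hL Xnd X01 gap_pos).
Qed.

End limit.
End one_species.

(** * Existence of a minimizer *)

Section existence.
Context (R : realType) (S : finType) (lam : S -> R) (beta : nat -> R)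
  (Delta2 : forall p : nat, p.-tuple S -> R).

Lemma tame_scale (K c : R) (f : (S -> R) -> R) : 0 <= c -> tame K f ->
  tame (c * K) (fun q => c * f q).
Proof.
move=> c0 fK q q' cq cq'; have [/andP[f0 f1] fle flip] := fK q q' cq cq'; split.
- by rewrite mulr_ge0//= ler_wpM2l.
- by move=> qq'; rewrite ler_wpM2l// fle.
- by rewrite -mulrBr normrM (ger0_norm c0) -mulrA ler_wpM2l.
Qed.

Let xis := xi_s lam beta Delta2.
Let th := theta lam beta Delta2.

Lemma parisi_AE zeta Phi b : parisi_A lam beta Delta2 zeta Phi b =
  \sum_s lam s / 2 *
    species_term (xis s (fun=> 0)) (cdf01 zeta) (xis s \o Phi) (b s)
  - 2^-1 * stieltjes (cdf01 zeta) (th \o Phi) 0 1.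
Proof.
rewrite /parisi_A; congr (_ - _); apply: eq_bigr => s _; congr (_ * _).
by rewrite /species_term; congr (_ + _); apply: eq_Rintegral => q _; rewrite mulrC.
Qed.

Hypothesis lam_gt0 : forall s, 0 < lam s.
Variables (K : S -> R) (Kt : R).
Hypothesis xis_tame : forall s, tame (K s) (xis s).
Hypothesis th_tame : tame Kt th.

Let Lx s := K s * path_slope lam.
Let Lt := Kt * path_slope lam.

Definition feasible (zeta : probability (measurableTypeR R) R) Phi (b : S -> R) :=
  admissible_pair lam zeta Phi /\
  forall s, 0 < b s /\ d_s lam beta Delta2 zeta Phi s 0 < b s.

Lemma cube0 : cube ((fun=> 0) : S -> R).
Proof. by move=> s; rewrite lexx ler01. Qed.

Section one_pair.
Variables (zeta : probability (measurableTypeR R) R) (Phi : R -> S -> R) (b : S -> R).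
Hypothesis vb : feasible zeta Phi b.
Let X := cdf01 zeta.
Let h s := xis s \o Phi.

Let aPhi : admissible_map lam Phi. Proof. by case: vb => -[]. Qed.

Lemma feasible_lip s : mono_lip01 (Lx s) (h s).
Proof. exact: path_mono_lip01. Qed.

Lemma feasible_theta_lip : mono_lip01 Lt (th \o Phi).
Proof. exact: path_mono_lip01. Qed.

Lemma feasible_gap s : 0 < b s - stieltjes X (h s) 0 1.
Proof. by rewrite subr_gt0; have [_ /(_ s)[]] := vb. Qed.

Lemma theta_integral_le : stieltjes X (th \o Phi) 0 1 <= Kt.
Proof.
have hL := feasible_theta_lip.
apply: (@le_trans _ _ (stieltjes (fun=> 1) (th \o Phi) 0 1)).
  apply: (le_stieltjes hL (nd01_bounded_meas (@cdf01_nd _ zeta)) (bounded_meas01_cst 1)) => // x x01.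
  by have /andP[] := @cdf01_range01 _ zeta x x01.
rewrite (stieltjes_cst _ hL)// mul1r /=.
have c0 : cube (Phi 0) by apply: (admissible_cube aPhi); rewrite lexx ler01.
have c1 : cube (Phi 1) by apply: (admissible_cube aPhi); rewrite lexx ler01.
have [/andP[t0 _] _ _] := th_tame c0 c1; have [/andP[_ t1] _ _] := th_tame c1 c0.
by rewrite (le_trans _ t1)// gerBl.
Qed.

Let z0 s : 0 <= xis s (fun=> 0).
Proof. by have [/andP[]] := xis_tame s cube0 cube0. Qed.

Let gap_le_level s : b s - stieltjes X (h s) 0 1 <= b s.
Proof.
rewrite gerBl; apply: (tail_ge0 (feasible_lip s) (@cdf01_nd _ zeta) (@cdf01_range01 _ zeta)).
by rewrite lexx ler01.
Qed.

Lemma species_term_ge_entropy s :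
  b s - 1 - ln (b s - stieltjes X (h s) 0 1) <= species_term (xis s (fun=> 0)) X (h s) (b s).
Proof.
exact: (species_term_ge (feasible_lip s) (@cdf01_nd _ zeta) (@cdf01_range01 _ zeta) (z0 s) (feasible_gap s)).
Qed.

Lemma entropy_ge0 s : 0 <= b s - 1 - ln (b s - stieltjes X (h s) 0 1).
Proof.
by have := ln_le_subr1 (feasible_gap s); have := gap_le_level s; lra.
Qed.

Lemma parisi_A_ge : - (Kt / 2) <= parisi_A lam beta Delta2 zeta Phi b.
Proof.
rewrite parisi_AE; have := theta_integral_le; rewrite -/X.
have : 0 <= \sum_s lam s / 2 * species_term (xis s (fun=> 0)) X (xis s \o Phi) (b s).
  apply: sumr_ge0 => s _; rewrite mulr_ge0 ?divr_ge0 ?(ltW (lam_gt0 s))//.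
  exact: le_trans (entropy_ge0 s) (species_term_ge_entropy s).
by lra.
Qed.

(** All terms of the sum over the species are nonnegative, so a bound on A bounds
each of them. *)
Lemma coercive (C : R) s : parisi_A lam beta Delta2 zeta Phi b <= C ->
  let C2 := (C + Kt / 2) * 2 / lam s in
  expR (- 1 - C2) <= b s - stieltjes X (h s) 0 1 /\ b s <= 2 * (C2 + ln 2).
Proof.
move=> AC C2; apply: entropy_bounds; [exact: feasible_gap|exact: gap_le_level|].
rewrite /C2 ler_pdivlMr// -ler_pdivrMr// -mulrA mulrC.
apply: (@le_trans _ _ (lam s / 2 * species_term (xis s (fun=> 0)) X (h s) (b s))).
  by rewrite ler_wpM2l ?species_term_ge_entropy// divr_ge0// ltW.
have : lam s / 2 * species_term (xis s (fun=> 0)) X (h s) (b s) <=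
    \sum_s lam s / 2 * species_term (xis s (fun=> 0)) X (xis s \o Phi) (b s).
  rewrite (bigD1 s)//= lerDl; apply: sumr_ge0 => i _.
  rewrite mulr_ge0 ?divr_ge0 ?(ltW (lam_gt0 i))//.
  exact: le_trans (entropy_ge0 i) (species_term_ge_entropy i).
move: AC; rewrite parisi_AE; have := theta_integral_le; rewrite -/X.
by lra.
Qed.

End one_pair.

(** The data converge along an ultrafilter finer than the filter of neighbourhoods
of infinity, so that A keeps its limit m. *)
Lemma feasible_compactness (zeta_ : nat -> probability (measurableTypeR R) R)
    (Phi_ : nat -> R -> S -> R) (b_ : nat -> S -> R) (C m : R) :
  (forall n, feasible (zeta_ n) (Phi_ n) (b_ n)) ->
  (forall n, parisi_A lam beta Delta2 (zeta_ n) (Phi_ n) (b_ n) <= C) ->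
  parisi_A lam beta Delta2 (zeta_ n) (Phi_ n) (b_ n) @[n --> \oo] --> m ->
  exists zeta Phi b, feasible zeta Phi b /\ parisi_A lam beta Delta2 zeta Phi b = m.
Proof.
move=> val_ AC Acv.
have [U [UU oU]] := ultraFilterLemma (@eventually_filter).
have UP : ProperFilter U by exact: ultra_proper.
have {}Acv : parisi_A lam beta Delta2 (zeta_ n) (Phi_ n) (b_ n) @[n --> U] --> m.
  by apply: cvg_trans Acv; exact: cvg_app oU.
pose X_ n := cdf01 (zeta_ n).
pose Xb x := ulim U (fun n => X_ n x).
have zeta1_ n : zeta_ n `[0, 1]%classic = 1%E by case: (val_ n) => -[].
have aPhi_ n : admissible_map lam (Phi_ n) by case: (val_ n) => -[].
have Xcv (x : R) : 0 <= x <= 1 -> X_ n x @[n --> U] --> Xb x.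
  by move=> x01; apply: cvg_ulim => n; exact: cdf01_range01 x01.
pose Phi x s := ulim U (fun n => Phi_ n x s).
have Pcv x s : 0 <= x <= 1 -> Phi_ n x s @[n --> U] --> Phi x s.
  by move=> x01; apply: cvg_ulim => n; exact: (admissible_cube (aPhi_ n) x01).
have aPhi : admissible_map lam Phi by exact: (admissible_limit lam_gt0 UP aPhi_ Pcv).
pose C2 s := (C + Kt / 2) * 2 / lam s.
pose b s := ulim U (fun n => b_ n s).
have bcv s : b_ n s @[n --> U] --> b s.
  apply: (@cvg_ulim R U UU _ 0 (2 * (C2 s + ln 2))) => n.
  have [_ /(_ s)[/ltW -> _]] := val_ n.
  by have [_] := coercive (val_ n) s (AC n).
have Xb1 : Xb 1 = 1.
  apply: cvg_lim => //; apply: cvg_near_cst; apply: nearW => n.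
  exact: cdf01_1.
have [zeta [zeta1 XbX XXb]] := right_regularization_measure
  (nd01_cvg UP (fun n => @cdf01_nd _ (zeta_ n)) Xcv)
  (range01_cvg UP (fun n => @cdf01_range01 _ (zeta_ n)) Xcv) Xb1.
have hcv f K' (x : R) : tame K' f -> 0 <= x <= 1 ->
    (f \o Phi_ n) x @[n --> U] --> (f \o Phi) x.
  move=> fK x01; apply: (tame_cvg UP fK) => [n|s]; first exact: admissible_cube.
  exact: Pcv.
have del0 s : 0 < expR (- 1 - C2 s) by exact: expR_gt0.
have gap_ s n : expR (- 1 - C2 s) <= b_ n s - stieltjes (X_ n) (xis s \o Phi_ n) 0 1.
  by have [] := coercive (val_ n) s (AC n).
have Tcv s := species_term_cvg UP (z := xis s (fun=> 0)) (fun n => feasible_lip (val_ n) s)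
  (fun n => @cdf01_nd _ (zeta_ n)) (fun n => @cdf01_range01 _ (zeta_ n)) Xcv
  (fun x => hcv _ _ x (xis_tame s)) (@cdf01_nd _ zeta) (@cdf01_range01 _ zeta) XbX XXb
  (bcv s) (del0 s) (gap_ s).
have Ccv := stieltjes_cvg UP (fun n => feasible_theta_lip (val_ n))
  (fun n => @cdf01_nd _ (zeta_ n)) (fun n => @cdf01_range01 _ (zeta_ n)) Xcv
  (fun x => hcv _ _ x th_tame) (@cdf01_nd _ zeta) (@cdf01_range01 _ zeta) XbX XXb
  (lexx 0) ler01 (lexx 1).
exists zeta, Phi, b; split.
  split; first by split.
  move=> s.
  have gl := gap_limit UP (fun n => feasible_lip (val_ n) s)
    (fun n => @cdf01_nd _ (zeta_ n)) (fun n => @cdf01_range01 _ (zeta_ n)) Xcv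
    (fun x => hcv _ _ x (xis_tame s)) (@cdf01_nd _ zeta) (@cdf01_range01 _ zeta) XbX XXb
    (bcv s) (gap_ s).
  split; last by rewrite -subr_gt0; exact: lt_le_trans gl.
  exact: (level_limit_gt0 UP (fun n => feasible_lip (val_ n) s)
    (fun n => @cdf01_nd _ (zeta_ n)) (fun n => @cdf01_range01 _ (zeta_ n)) Xcv
    (fun x => hcv _ _ x (xis_tame s)) (@cdf01_nd _ zeta) (@cdf01_range01 _ zeta) XbX XXb
    (bcv s) (del0 s) (gap_ s)).
suff Bcv : parisi_A lam beta Delta2 (zeta_ n) (Phi_ n) (b_ n) @[n --> U] -->
    parisi_A lam beta Delta2 zeta Phi b by exact: (cvg_unique _ Bcv Acv).
under eq_fun do rewrite parisi_AE.
rewrite parisi_AE; apply: cvgB; last by apply: cvgMr; exact: Ccv.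
apply: cvg_big => [|s _]; first exact: add_continuous.
by apply: cvgMr; exact: Tcv.
Qed.

End existence.

Theorem corollary1p6 (R : realType) (S : finType) (lam : S -> R)
    (beta : nat -> R) (Delta2 : forall p : nat, p.-tuple S -> R)
    (lam01 : forall s : S, 0 < lam s <= 1)
    (lam_sum1 : \sum_(s : S) lam s = 1)
    (Delta2_ge0 : forall (p : nat) (t : p.-tuple S),
       (1 <= p)%N -> 0 <= Delta2 p t)
    (Delta2_sym : forall (p : nat) (t u : p.-tuple S),
       (1 <= p)%N -> perm_eq t u -> Delta2 p t = Delta2 p u)
    (xi_summable : exists2 eps : R, 0 < eps &
       (\sum_(1 <= p <oo)
          (beta p ^+ 2 * (1 + eps) ^+ p *
             \sum_(t : p.-tuple S) Delta2 p t * mon lam t)%:E < +oo)%E) :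
  exists (zeta0 : probability (measurableTypeR R) R) (Phi0 : R -> S -> R),
    admissible_pair lam zeta0 Phi0 /\
    parisi lam beta Delta2 zeta0 Phi0 =
      ereal_inf [set parisi lam beta Delta2 x.1 x.2 | x in
        [set x : probability (measurableTypeR R) R * (R -> S -> R) |
           admissible_pair lam x.1 x.2]].
Proof.
have lam_gt0 s : 0 < lam s by case/andP: (lam01 s).
have lam_ge0 s : 0 <= lam s by exact: ltW.
have [rho [B [rho1 aB]]] := exists_radius lam_ge0 Delta2_ge0 xi_summable.
have tx s : tame ((lam s)^-1 * B) (xi_s lam beta Delta2 s).
  apply: tame_scale; first by rewrite invr_ge0.
  exact: (tame_partial lam_ge0 Delta2_ge0 rho1 aB).
have tt : tame B (theta lam beta Delta2).
  exact: (tame_theta lam_ge0 Delta2_ge0 rho1 aB).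
set I := ereal_inf _.
have I_le (zeta : probability (measurableTypeR R) R) Phi : admissible_pair lam zeta Phi ->
    (I <= parisi lam beta Delta2 zeta Phi)%E.
  by move=> adm; apply: ereal_inf_lbound; exists (zeta, Phi).
have le_I x : (forall zeta Phi b, feasible lam beta Delta2 zeta Phi b ->
    (x <= (parisi_A lam beta Delta2 zeta Phi b)%:E)%E) -> (x <= I)%E.
  move=> H; apply: le_ereal_inf_tmp => _ [[zeta Phi] /= adm <-].
  by apply: le_ereal_inf_tmp => _ [b /= bb <-]; exact: H.
have INy : ((- (B / 2))%:E <= I)%E.
  by apply: le_I => zeta Phi b vb; rewrite lee_fin; exact: (parisi_A_ge lam_gt0 tx tt vb).
(* If the infimum is +oo, any admissible pair attains it. *)
have [Iy|Iy] := eqVneq I +oo%E.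
  pose zeta0 : probability (measurableTypeR R) R := \d_(0 : measurableTypeR R).
  exists zeta0, (fun x _ => x).
  have adm : admissible_pair lam zeta0 (fun x _ => x).
    split; last exact: admissible_id.
    rewrite /zeta0 /= diracE mem_set//= in_itv/=; lra.
  by split => //; apply/eqP; rewrite eq_le I_le// Iy leey.
have Ifin : I \is a fin_num.
  by rewrite fin_numE Iy andbT; apply: contraTneq INy => ->.
set m := fine I.
have mE : I = m%:E by rewrite fineK.
have seqP n : exists t : probability (measurableTypeR R) R * (R -> S -> R) * (S -> R),
    feasible lam beta Delta2 t.1.1 t.1.2 t.2 /\
    parisi_A lam beta Delta2 t.1.1 t.1.2 t.2 < m + n.+1%:R^-1.
  have : (I < (m + n.+1%:R^-1)%:E)%E by rewrite mE lte_fin ltrDl invr_gt0.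
  move=> /ereal_inf_lt[_ [[zeta Phi] /= adm <-]].
  move=> /ereal_inf_lt[_ [b /= bb <-]]; rewrite lte_fin => Alt.
  by exists (zeta, Phi, b).
have {seqP} [t tP] := choice seqP.
have mA zeta Phi b : feasible lam beta Delta2 zeta Phi b ->
    m <= parisi_A lam beta Delta2 zeta Phi b.
  move=> [adm bb]; rewrite -lee_fin -mE; apply: (le_trans (I_le _ _ adm)).
  by apply: ereal_inf_lbound; exists b.
have [zeta [Phi [b [vb AE]]]] : exists zeta Phi b, feasible lam beta Delta2 zeta Phi b /\
    parisi_A lam beta Delta2 zeta Phi b = m.
  apply: (feasible_compactness lam_gt0 tx tt (C := m + 1)
    (zeta_ := fun n => (t n).1.1) (Phi_ := fun n => (t n).1.2) (b_ := fun n => (t n).2)).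
  - by move=> n; case: (tP n).
  - move=> n; have [_ /ltW/le_trans] := tP n; apply.
    by rewrite lerD2l invf_le1// ler1n.
  - apply: (@squeeze_cvgr _ _ _ _ (fun=> m) (fun n => m + n.+1%:R^-1)).
    + by apply: nearW => n; have [v /ltW ->] := tP n; rewrite mA.
    + exact: cvg_cst.
    + rewrite -[X in _ --> X]addr0; apply: cvgD; first exact: cvg_cst.
      exact: cvg_harmonic.
exists zeta, Phi; split; first by case: vb.
apply/eqP; rewrite eq_le I_le ?andbT; last by case: vb.
rewrite mE -AE; apply: ereal_inf_lbound; exists b => //.
by case: vb.
Qed.
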